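(* Consider the signal $\{x_k\}_{k\ge1}$, the observations $\{y_k\}_{k\ge1}$ (built from the linearized measurements $z_k=\gamma_k(H_kx_k+C_k)+v_k$), the innovations $\eta_k$ with covariance matrices $\Sigma^\eta_k$ (assumed nonsingular for every $k\ge1$), and the quantities $\Delta^a_k,\Psi^a_k,e^a_k,T^{ab}_k$ ($a,b\in\{x,v\}$), all as specified in the context, under all the hypotheses listed there. Fix $k\ge1$. Starting from the LS linear filter $\widehat x_{k/k}$, the LS linear fixed-point smoothers $\widehat x_{k/L}$, $L>k$, satisfy the recursion $$\widehat{x}_{k/L}=\widehat{x}_{k/L-1}+\mathcal{S}^{x}_{k,L}(\Sigma^{\eta}_L)^{-1}\eta_{L},\quad L>k,$$ where $\mathcal S^x_{k,L}=\mathbb E[x_k\eta_L^T]$ is given by $$\mathcal{S}^{x}_{k,L}=(1-\overline{\lambda}_{L})\Big[\big(B_k-M_{k,L-1}^x\big)(\Delta_L^x)^T-M_{k,L-1}^v(\Delta_L^v)^T\Big],\quad L>k,$$ and the matrices $M_{k,L}^a=\mathbb{E}[x_k(e^{a}_{L})^T]$, $a=x,v$, are recursively calculated by $$M_{k,L}^a=M_{k,L-1}^a+\mathcal{S}^{x}_{k,L}(\Sigma^{\eta}_L)^{-1}(\Psi_L^{a})^T,\quad L>k;\qquad M_{k,k}^a=A_kT_k^{xa}.$$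
   Context: Notation: $\mathbb E$ is expectation, $\overline a=\mathbb E[a]$, $Cov[a,b]=\mathbb E[(a-\overline a)(b-\overline b)^T]$, $Cov[a]=Cov[a,a]$. ''White sequence'' means a sequence of pairwise uncorrelated random vectors. All random vectors are real, defined on a common probability space and have finite second moments. Signal. $\{x_k\}_{k\ge1}$ is a zero-mean second-order $\mathbb R^{n_x}$-valued process with $Cov[x_k,x_s]=A_kB_s^T$ for $s\le k$, where $A_k,B_s\in\mathbb R^{n_x\times p}$ are known deterministic matrices. Measurements. $\{\gamma_k\}_{k\ge1}$ are independent Bernoulli random variables with $\overline\gamma_k=\mathbb E[\gamma_k]$. For each $k$, $h_k:\mathbb R^{n_x}\to\mathbb R^{n_z}$ is an analytic function; the original nonlinear measurement is $z_k=\gamma_kh_k(x_k)+v_k$. Given a deterministic nominal trajectory $\{x_k^0\}_{k\ge1}\subset\mathbb R^{n_x}$, put $H_k=\frac{\partial h_k(x)}{\partial x}\big|_{x=x_k^0}$ (the $n_z\times n_x$ Jacobian) and $C_k=h_k(x_k^0)-H_kx_k^0$. Throughout, the measurement is replaced by its linearization $$z_k=\gamma_k(H_kx_k+C_k)+v_k,\quad k\ge1.$$ Additive noise. $v_k=D_{k-1}v_{k-1}+u_{k-1}$, $k\ge1$, where each $D_k\in\mathbb R^{n_z\times n_z}$ ($k\ge0$) is nonsingular, $v_0$ is zero-mean with covariance $\Sigma^v_0$, and $\{u_k\}_{k\ge0}$ is a zero-mean white sequence with covariances $\Sigma^u_k=Cov[u_k]$, independent of $v_0$. Put $\Sigma^v_s=D_{s-1}\Sigma^v_{s-1}D_{s-1}^T+\Sigma^u_{s-1}$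 ($s\ge1$), $E_k=D_{k-1}\cdots D_0$ and $F_s=\Sigma^v_s(E_s^{-1})^T$; then $Cov[v_k,v_s]=E_kF_s^T$ for $s\le k$. Deception attacks. The available observations are $y_k=(1-\lambda_k)z_k+\lambda_kw_k$, $k\ge1$, where $\{w_k\}_{k\ge1}$ is a zero-mean white $\mathbb R^{n_z}$-valued sequence with $\Sigma^w_k=Cov[w_k]$, and $\{\lambda_k\}_{k\ge1}$ are independent Bernoulli random variables with $\overline\lambda_k=\mathbb E[\lambda_k]$. Independence. The processes $\{x_k\}_{k\ge1}$, $\{\gamma_k\}_{k\ge1}$, $\{v_k\}_{k\ge1}$, $\{w_k\}_{k\ge1}$, $\{\lambda_k\}_{k\ge1}$ are mutually independent. Estimators and innovations. For a random vector $\zeta$, the least-squares (LS) linear estimator based on $y_1,\dots,y_L$ is the componentwise orthogonal projection in $L^2$ of $\zeta$ onto the span of the constant $1$ and the components of $y_1,\dots,y_L$ (for $L=0$ it is $\mathbb E[\zeta]$); the estimator of $a_k$ is denoted $\widehat a_{k/L}$; it is the filter if $L=k$ and a fixed-point smoother if $L>k$ with $k$ fixed. The innovation is $\eta_k=y_k-\widehat y_{k/k-1}$, with $\Sigma^\eta_k=\mathbb E[\eta_k\eta_k^T]$, assumed nonsingular for all $k\ge1$. Auxiliary quantities. $\Gamma^x_k=\overline\gamma_kH_kB_k$, $\Gamma^v_k=F_k$, $\Delta^x_k=\overline\gamma_kH_kA_k$, $\Delta^v_k=E_k$. For $a,b\in\{x,v\}$ and $k\ge1$, recursively, $$\Psi^{a}_k=(1-\overline{\lambda}_k)\big(\Gamma_k^a-\Delta^{x}_kT^{xa}_{k-1}-\Delta^{v}_kT^{va}_{k-1}\big)^T,$$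 $$e^{a}_k=e^{a}_{k-1}+\Psi^{a}_k(\Sigma^{\eta}_k)^{-1}\eta_k,\quad e^a_0=0,\qquad T^{ab}_k=T^{ab}_{k-1}+\Psi^{a}_k(\Sigma^{\eta}_k)^{-1}(\Psi^{b}_k)^T,\quad T^{ab}_0=0.$$ *)

(* Defs.v *)
From mathcomp Require Import all_boot all_order all_algebra finmap.
From mathcomp Require Import all_classical all_reals all_analysis.

Set Implicit Arguments.
Unset Strict Implicit.
Unset Printing Implicit Defensive.

Import Order.TTheory GRing.Theory Num.Theory.
Import numFieldNormedType.Exports.

Local Open Scope classical_set_scope.
Local Open Scope ring_scope.

Section Analytic.
Context {R : realType} {n m : nat}.

(* Near every point a, each component of f is the sum of an absolutely
   convergent power series in x - a.  Multi-indices are finite functions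
   alpha : 'I_n -> nat; the sum of a summable family is the difference of the
   sums of its positive and negative parts. *)
Definition power_term (c : {ffun 'I_n -> nat} -> R) (a x : 'cV[R]_n)
    (alpha : {ffun 'I_n -> nat}) : \bar R :=
  (c alpha * \prod_i (x i ord0 - a i ord0) ^+ alpha i)%:E.

Definition analytic (f : 'cV[R]_n -> 'cV[R]_m) : Prop :=
  forall (a : 'cV[R]_n) (j : 'I_m),
    exists c : {ffun 'I_n -> nat} -> R, \forall x \near a,
      summable setT (power_term c a x) /\
      (f x j ord0)%:E = (\esum_(alpha in setT) (power_term c a x)^\+ alpha -
                         \esum_(alpha in setT) (power_term c a x)^\- alpha)%E.

(* The library's Jacobian acts on row vectors by right multiplication; the
   m x n matrix of partial derivatives is its transpose. *)
Definition col_jacobian (f : 'cV[R]_n -> 'cV[R]_m) (a : 'cV[R]_n) :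
    'M[R]_(m, n) :=
  ('J (fun r : 'rV[R]_n => (f r^T)^T) a^T)^T.

End Analytic.

Section RandomVectors.
Context {d : measure_display} {T : measurableType d} {R : realType}
        (P : probability T R).

Definition coord_rv n (X : T -> 'cV[R]_n) (i : 'I_n) : T -> R :=
  fun w => X w i ord0.

Definition second_order n (X : T -> 'cV[R]_n) : Prop :=
  forall i, coord_rv X i \in Lfun P 2%:E.

Definition Emx m n (X : T -> 'M[R]_(m, n)) : 'M[R]_(m, n) :=
  \matrix_(i, j) fine 'E_P[fun w => X w i j]%E.

Definition Covmx m n (X : T -> 'cV[R]_m) (Y : T -> 'cV[R]_n) : 'M[R]_(m, n) :=
  \matrix_(i, j) fine (covariance P (coord_rv X i) (coord_rv Y j)).

Definition bernoulli_rv (X : T -> R) : Prop :=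
  measurable_fun setT X /\ {ae P, forall w, X w = 0 \/ X w = 1}.

(* Sigma-algebra generated by the real random variables X i, i in D. *)
Definition sigma_of (I : Type) (D : set I) (X : I -> T -> R) : set_system T :=
  <<s \bigcup_(i in D) preimage_set_system setT (X i) measurable >>.

Definition sigma_process n (K : set nat) (X : nat -> T -> 'cV[R]_n) :
    set_system T :=
  sigma_of [set ki : nat * 'I_n | K ki.1] (fun ki => coord_rv (X ki.1) ki.2).

Definition mutually_independent (I : choiceType) (D : set I)
    (F : I -> set_system T) : Prop :=
  forall J : {fset I}, [set` J] `<=` D ->
  forall A : I -> set T, (forall i, i \in J -> F i (A i)) ->
    P (\bigcap_(i in [set` J]) A i) = (\prod_(i <- J) P (A i))%E.

(* Elements of L^2(P) are represented by functions, identified almost surely. *)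
Definition obs_span nz (y : nat -> T -> 'cV[R]_nz) (L : nat) : set (T -> R) :=
  [set g | g \in Lfun P 2%:E /\
     exists (a : R) (c : nat -> 'rV[R]_nz),
       {ae P, forall w,
          g w = a + \sum_(1 <= j < L.+1) (c j *m y j w) ord0 ord0}].

Definition orth_proj (V : set (T -> R)) (f g : T -> R) : Prop :=
  V g /\ forall h, V h -> ('E_P[((f \- g) \* h)%R] = 0)%E.

Definition LS_estimator nz (y : nat -> T -> 'cV[R]_nz) (L : nat) n
    (zeta zetahat : T -> 'cV[R]_n) : Prop :=
  forall i, orth_proj (obs_span y L) (coord_rv zeta i) (coord_rv zetahat i).

End RandomVectors.

(* All sequences are indexed by nat.  The values at index 0 of signal, facA,
   facB, gam, meas, nominal, attack and lam are irrelevant: the time origin is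
   1 for them, and 0 for noise, trans and drive. *)
Record system (R : realType) (T : Type) (nx nz p : nat) := System {
  signal : nat -> T -> 'cV[R]_nx;           (* x_k *)
  facA : nat -> 'M[R]_(nx, p);              (* A_k *)
  facB : nat -> 'M[R]_(nx, p);              (* B_k *)
  gam : nat -> T -> R;                      (* gamma_k *)
  meas : nat -> 'cV[R]_nx -> 'cV[R]_nz;     (* h_k *)
  nominal : nat -> 'cV[R]_nx;               (* x_k^0 *)
  noise : nat -> T -> 'cV[R]_nz;            (* v_k *)
  trans : nat -> 'M[R]_nz;                  (* D_k *)
  drive : nat -> T -> 'cV[R]_nz;            (* u_k *)
  attack : nat -> T -> 'cV[R]_nz;           (* w_k *)
  lam : nat -> T -> R }.                    (* lambda_k *)

Variant kind := kx | kv.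

Section Model.
Context {d : measure_display} {T : measurableType d} {R : realType}
        (P : probability T R) {nx nz p : nat} (S : system R T nx nz p).

Definition gambar k : R := fine 'E_P[gam S k]%E.
Definition lambar k : R := fine 'E_P[lam S k]%E.

Definition Hmx k : 'M[R]_(nz, nx) := col_jacobian (meas S k) (nominal S k).

Definition Cvec k : 'cV[R]_nz :=
  meas S k (nominal S k) - Hmx k *m nominal S k.

Definition zlin k (w : T) : 'cV[R]_nz :=
  gam S k w *: (Hmx k *m signal S k w + Cvec k) + noise S k w.

Definition obs k (w : T) : 'cV[R]_nz :=
  (1 - lam S k w) *: zlin k w + lam S k w *: attack S k w.

Fixpoint Sigma_v k : 'M[R]_nz :=
  if k is k'.+1 then
    trans S k' *m Sigma_v k' *m (trans S k')^T + Covmx P (drive S k') (drive S k')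
  else Covmx P (noise S 0) (noise S 0).

Fixpoint Emat k : 'M[R]_nz := if k is k'.+1 then trans S k' *m Emat k' else 1%:M.

Definition Fmat k : 'M[R]_nz := Sigma_v k *m (invmx (Emat k))^T.

Record assumptions : Prop := Assumptions {
  signal_L2 : forall k, (1 <= k)%N -> second_order P (signal S k);
  signal_mean0 : forall k, (1 <= k)%N -> Emx P (signal S k) = 0;
  signal_cov : forall k s, (1 <= s <= k)%N ->
    Covmx P (signal S k) (signal S s) = facA S k *m (facB S s)^T;
  gam_bernoulli : forall k, (1 <= k)%N -> bernoulli_rv P (gam S k);
  gam_indep : mutually_independent P [set k | (1 <= k)%N]
    (fun k => sigma_of [set k] (gam S));
  meas_analytic : forall k, (1 <= k)%N -> analytic (meas S k);
  noise_rec : forall k, (1 <= k)%N -> forall w,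
    noise S k w = trans S k.-1 *m noise S k.-1 w + drive S k.-1 w;
  trans_unit : forall k, trans S k \in unitmx;
  noise0_L2 : second_order P (noise S 0);
  noise0_mean0 : Emx P (noise S 0) = 0;
  drive_L2 : forall k, second_order P (drive S k);
  drive_mean0 : forall k, Emx P (drive S k) = 0;
  drive_white : forall j k, j <> k -> Covmx P (drive S j) (drive S k) = 0;
  drive_noise0_indep : mutually_independent P setT
    (fun b : bool => if b then sigma_process setT (drive S)
                     else sigma_process [set 0%N] (noise S));
  attack_L2 : forall k, (1 <= k)%N -> second_order P (attack S k);
  attack_mean0 : forall k, (1 <= k)%N -> Emx P (attack S k) = 0;
  attack_white : forall j k, (1 <= j)%N -> (1 <= k)%N -> j <> k ->
    Covmx P (attack S j) (attack S k) = 0;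
  lam_bernoulli : forall k, (1 <= k)%N -> bernoulli_rv P (lam S k);
  lam_indep : mutually_independent P [set k | (1 <= k)%N]
    (fun k => sigma_of [set k] (lam S));
  processes_indep :
    let K := [set k | (1 <= k)%N] in
    mutually_independent P setT
      (tnth [tuple sigma_process K (signal S); sigma_of K (gam S);
                   sigma_process K (noise S); sigma_process K (attack S);
                   sigma_of K (lam S)]) }.

Definition dim (a : kind) : nat := if a is kx then p else nz.

Definition Gam (a : kind) k : 'M[R]_(nz, dim a) :=
  match a with
  | kx => gambar k *: (Hmx k *m facB S k)
  | kv => Fmat k
  end.

Definition Del (a : kind) k : 'M[R]_(nz, dim a) :=
  match a with
  | kx => gambar k *: (Hmx k *m facA S k)
  | kv => Emat k
  end.

Section Innovations.
(* yhat k is a version of the one-step predictor of y_k. *)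
Context (yhat : nat -> T -> 'cV[R]_nz).

Definition eta k (w : T) : 'cV[R]_nz := obs k w - yhat k w.

Definition Sigma_eta k : 'M[R]_nz := Emx P (fun w => eta k w *m (eta k w)^T).

(* Psi^a_k as a function of the family T^{ab}_{k-1}. *)
Definition Psi_of (Tprev : forall a b, 'M[R]_(dim a, dim b)) k a :
    'M[R]_(dim a, nz) :=
  (1 - lambar k) *:
    (Gam a k - Del kx k *m Tprev kx a - Del kv k *m Tprev kv a)^T.

Fixpoint Tmx k : forall a b, 'M[R]_(dim a, dim b) :=
  if k is k'.+1 then fun a b =>
    Tmx k' a b + Psi_of (Tmx k') k a *m invmx (Sigma_eta k)
                   *m (Psi_of (Tmx k') k b)^T
  else fun _ _ => 0.

Definition Psi (a : kind) k : 'M[R]_(dim a, nz) := Psi_of (Tmx k.-1) k a.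

Fixpoint evec (a : kind) k (w : T) : 'cV[R]_(dim a) :=
  if k is k'.+1 then
    evec a k' w + Psi a k *m invmx (Sigma_eta k) *m eta k w
  else 0.

Definition Smx k L : 'M[R]_(nx, nz) :=
  Emx P (fun w => signal S k w *m (eta L w)^T).

Definition Mmx (a : kind) k L : 'M[R]_(nx, dim a) :=
  Emx P (fun w => signal S k w *m (evec a L w)^T).

End Innovations.
End Model.

(* Main.v *)
From HB Require Import structures.
Require Import Defs.
From mathcomp Require Import all_boot all_order all_algebra finmap.
From mathcomp Require Import all_classical all_reals all_analysis measurable_realfun.

(* Everything takes place in L^2, with the matrix-valued inner product
   cross X Y = E[X Y^T].  With
     m_L = (1 - E lam_L) (E gam_L (H_L x_L + C_L) + v_L),
   the independence assumptions make y_L - m_L orthogonal to 1, to all x_k and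
   v_k, and to y_1, ..., y_{L-1}: condition first on lam_L, which is independent
   of everything else in sight, then on gam_L, and use that w_L is centred and
   white.  So y_L may be replaced by m_L in inner products with the past, and a
   strong induction on L gives E[x_k eta_L^T] = A_k Psi^x_L and
   E[v_k eta_L^T] = E_k Psi^v_L for k >= L together with the closed form
     yhat_L = E y_L + (1 - E lam_L) (Del^x_L e^x_{L-1} + Del^v_L e^v_{L-1}).
   The smoothing formulas follow by taking the inner product of x_k with
   eta_L = y_L - yhat_L, and the recursion for xhat by uniqueness of
   projections. *)

Set Implicit Arguments.
Unset Strict Implicit.
Unset Printing Implicit Defensive.

Import Order.TTheory GRing.Theory Num.Theory.
Import numFieldNormedType.Exports.

Local Open Scope classical_set_scope.
Local Open Scope ring_scope.

(** * Independence of generated sigma-algebras *)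

Section Independence.
Context d (T : measurableType d) (R : realType) (P : probability T R).
Local Open Scope ereal_scope.

(** The factors lam_L and gamma_L multiply other random variables, so pulling out their means takes
    joint independence from everything else. The assumptions give this in pieces only: independence
    in time inside a process, and independence between processes. The pieces are assembled by
    pi-system arguments on generated sigma-algebras. The sequences w_k and u_k are merely white, so
    their own correlations in time are handled through covariances. The factorisations A_k B_s^T and
    E_k F_s^T hold for s <= k only, so E[x_k eta_L^T] has the left factor A_k as long as L <= k. For
    L > k the covariance of x_k with x_L is B_k A_L^T, that factor is lost, and the matrices M_{k,L}
    need a recursion of their own. *)

Definition indep (G1 G2 : set_system T) : Prop :=
  forall A B, <<s G1 >> A -> <<s G2 >> B -> P (A `&` B) = P A * P B.

Lemma sigma_gen_measurable (G : set_system T) :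
  G `<=` measurable -> <<s G >> `<=` measurable.
Proof. exact: (smallest_sub (@sigma_algebra_measurable _ T)). Qed.

Lemma sigma_genT (G : set_system T) : <<s G >> setT.
Proof. exact: (@measurableT _ (g_sigma_algebraType G)). Qed.

Lemma sigma_genI (G : set_system T) : setI_closed <<s G >>.
Proof. by move=> A B; exact: (@measurableI _ (g_sigma_algebraType G)). Qed.

Lemma indepS (G1 G2 H1 H2 : set_system T) :
  G1 `<=` <<s H1 >> -> G2 `<=` <<s H2 >> -> indep H1 H2 -> indep G1 G2.
Proof.
move=> s1 s2 h A B GA GB; apply: h.
- by apply: (smallest_sub (smallest_sigma_algebra _ _) s1).
- by apply: (smallest_sub (smallest_sigma_algebra _ _) s2).
Qed.

(** For fixed A, the finite measures sending B to the probability of A and B together and to P(A)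
    P(B) agree on the pi-system [C], hence on the sigma-algebra it generates. *)
Lemma indep_pi (G1 C : set_system T) :
  G1 `<=` measurable -> C `<=` measurable -> setI_closed C -> C setT ->
  (forall A B, <<s G1 >> A -> C B -> P (A `&` B) = P A * P B) ->
  indep G1 C.
Proof.
move=> mG1 mC CI CT h A B GA GB.
have mA : measurable A by exact: (sigma_gen_measurable mG1).
have PA : P A = (fine (P A))%:E by rewrite fineK// fin_num_measure.
(* [mscale] takes a nonnegative real, so P(A) is needed as a number. *)
pose r : {nonneg R} := NngNum (fine_ge0 (measure_ge0 P A)).
rewrite setIC PA.
apply: (@g_sigma_algebra_measure_unique _ R T C mC (fun=> setT) (fun=> CT)
  _ (mrestr P mA) (mscale r P) CI _ _ B GB).
- by rewrite bigcup_const.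
- by move=> X CX; rewrite /= /mrestr /mscale setIC h//= PA.
- by move=> _; rewrite /= /mrestr setTI PA ltry.
Qed.

(** Finite intersections of events from the [F j] with j distinct from i form a pi-system generating
    the second family, and on it the product rule is the assumed one. *)
Lemma mutually_independent_indep (I : choiceType) (D : set I)
    (F : I -> set_system T) (i : I) :
  D i -> (forall j, D j -> F j `<=` measurable) ->
  (forall j, D j -> F j setT) -> (forall j, D j -> setI_closed (F j)) ->
  sigma_algebra setT (F i) ->
  mutually_independent P D F ->
  indep (F i) (\bigcup_(j in D `\ i) F j).
Proof.
move=> Di mF FT FI sFi mi.
pose C : set_system T := [set B | exists (J : {fset I}) (A : I -> set T),
  [/\ [set` J] `<=` D `\ i, (forall j, j \in J -> F j (A j)) &
      B = \bigcap_(j in [set` J]) A j]].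
have mFi := mF _ Di.
have CI : setI_closed C.
  move=> _ _ [J [A [JD JA ->]]] [J' [A' [JD' JA' ->]]].
  (* Padding with [setT] lets both intersections run over the union of the index sets. *)
  exists (J `|` J')%fset,
    (fun j => (if j \in J then A j else setT) `&`
              (if j \in J' then A' j else setT)); split.
  - by move=> j /=; rewrite inE => /orP[/JD|/JD'].
  - move=> j; rewrite inE => Jj.
    have Dj : D j by case/orP: Jj => [/JD|/JD'] [].
    by apply: FI => //; case: ifPn => // ?; [exact: JA|exact: FT|exact: JA'|exact: FT].
  - apply/seteqP; split=> [x [h h'] j /= Jj|x h].
      by split; case: ifPn => // ?; [exact: h|exact: h'].
    by split=> j /= Jj; have /= := h j; rewrite inE Jj ?orbT => /(_ isT) [].
have h : forall A B, <<s F i >> A -> C B -> P (A `&` B) = P A * P B.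
  move=> A B0; rewrite sigma_algebra_id// => FA [J [B [JD JB ->]]].
  have iJ : i \notin J by apply/negP => /JD[_]; exact.
  (* As i is not in [J], the event [A] can be put at i and the product rule used for [J] enlarged by
     i, then once more for [J] alone. *)
  pose B' := fun j => if j == i then A else B j.
  have B'J j : j \in J -> B' j = B j.
    by rewrite /B'; case: eqVneq => // -> ij; rewrite ij in iJ.
  have B'i : B' i = A by rewrite /B' eqxx.
  have := mi (i |` J)%fset _ B'; rewrite big_fsetU1//= B'i.
  have -> : (\bigcap_(j in [set` (i |` J)%fset]) B' j) =
            A `&` \bigcap_(j in [set` J]) B j.
    apply/seteqP; split=> [x h|x [hA h] j /=].
      split; first by rewrite -B'i; apply: h; rewrite /= !inE eqxx.
      by move=> j /= Jj; rewrite -B'J//; apply: h; rewrite /= !inE Jj orbT.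
    by rewrite !inE => /orP[/eqP ->|Jj]; [rewrite B'i|rewrite B'J//; exact: h].
  move=> -> //; first last.
  - by move=> j; rewrite !inE => /orP[/eqP ->|Jj]; [rewrite B'i|rewrite B'J//; exact: JB].
  - by move=> j /=; rewrite !inE => /orP[/eqP ->//|/JD[]].
  congr (_ * _).
  rewrite (mi J _ B)//; last by move=> j /JD[].
  by rewrite big_seq [RHS]big_seq; apply: eq_bigr => j Jj; rewrite B'J.
have mC : C `<=` measurable.
  move=> _ [J [A [JD JA ->]]].
  apply: fin_bigcap_measurable => [|j Jj]; first exact: finite_fset.
  by have [Dj _] := JD _ Jj; apply: (mF _ Dj); exact: JA.
have CT : C setT.
  exists fset0, (fun=> setT); split=> //.
  by apply/seteqP; split.
have := @indep_pi (F i) C mFi mC CI CT h.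
apply: indepS; first exact: sub_gen_smallest.
move=> A [j [Dj ij] FjA]; apply: sub_gen_smallest.
exists [fset j]%fset, (fun=> A); split.
- by move=> k /=; rewrite inE => /eqP ->.
- by move=> k; rewrite inE => /eqP ->.
- by apply/seteqP; split=> [x Ax k //|x]; apply; rewrite /= inE.
Qed.

(** On rectangles, P(A A' B) = P(A A') P(B) = P(A) P(A') P(B) = P(A) P(A' B). This merges
    independence inside a process with independence between processes. *)
Lemma indep_union (F1 F2 G : set_system T) :
  F1 `<=` measurable -> F2 `<=` measurable -> G `<=` measurable ->
  indep F1 F2 -> indep (F1 `|` F2) G -> indep F1 (F2 `|` G).
Proof.
move=> m1 m2 mG i12 iG.
pose C : set_system T := [set X | exists A B,
  [/\ <<s F2 >> A, <<s G >> B & X = A `&` B]].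
have s1 : <<s F1 >> `<=` <<s F1 `|` F2 >>.
  by apply: sub_smallest2r => //; exact: subsetUl.
have s2 : <<s F2 >> `<=` <<s F1 `|` F2 >>.
  by apply: sub_smallest2r => //; exact: subsetUr.
have := @indep_pi F1 C m1 _ _ _ _.
move=> h; suff: indep F1 C.
  apply: indepS; first exact: sub_gen_smallest.
  move=> A FA; apply: sub_gen_smallest; case: FA => FA.
    exists A, setT; split; [exact: sub_gen_smallest|exact: sigma_genT|by rewrite setIT].
  exists setT, A; split; [exact: sigma_genT|exact: sub_gen_smallest|by rewrite setTI].
apply: h.
- move=> _ [A [B [FA GB ->]]]; apply: measurableI.
    exact: (sigma_gen_measurable m2).
  exact: (sigma_gen_measurable mG).
- move=> _ _ [A [B [FA GB ->]]] [A' [B' [FA' GB' ->]]].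
  exists (A `&` A'), (B `&` B'); split; [exact: sigma_genI|exact: sigma_genI|].
  by rewrite setIACA.
- by exists setT, setT; split; [exact: sigma_genT|exact: sigma_genT|rewrite setIT].
- move=> A B0 FA [A' [B [FA' GB ->]]].
  rewrite setIA iG//; last by apply: sigma_genI; [exact: s1|exact: s2].
  by rewrite i12// -muleA iG//; exact: s2.
Qed.

Lemma sigma_gen_measurable_fun (G : set_system T) (X : T -> R) :
  G `<=` measurable ->
  measurable_fun setT (X : g_sigma_algebraType G -> R) -> measurable_fun setT X.
Proof.
by move=> mG mX _ B mB; apply: (sigma_gen_measurable mG); exact: mX.
Qed.

(** The law of (X, Y) is the product of the two laws, so the expectation of the product splits by
    Fubini, integrability being read off from the law of the pair. *)
Lemma expectation_indep (G1 G2 : set_system T) (X Y : T -> R) :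
  G1 `<=` measurable -> G2 `<=` measurable -> indep G1 G2 ->
  measurable_fun setT (X : g_sigma_algebraType G1 -> R) ->
  measurable_fun setT (Y : g_sigma_algebraType G2 -> R) ->
  X \in Lfun P 1 -> Y \in Lfun P 1 -> (X \* Y)%R \in Lfun P 1 ->
  'E_P[X \* Y] = 'E_P[X] * 'E_P[Y].
Proof.
move=> mG1 mG2 i12 sX sY X1 Y1 XY1.
have mX := sigma_gen_measurable_fun mG1 sX.
have mY := sigma_gen_measurable_fun mG2 sY.
have mXY : measurable_fun setT (fun w => (X w, Y w)) by exact: measurable_fun_pair.
pose Xm : {RV P >-> R} := HB.pack X (isMeasurableFun.Build _ _ _ _ _ mX).
pose Ym : {RV P >-> R} := HB.pack Y (isMeasurableFun.Build _ _ _ _ _ mY).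
pose XYm : {RV P >-> (R * R)%type} :=
  HB.pack (fun w => (X w, Y w)) (isMeasurableFun.Build _ _ _ _ _ mXY).
pose f (z : R * R) : \bar R := (z.1 * z.2)%:E.
have mf : measurable_fun [set: (R * R)%type] f.
  by apply/measurable_EFinP; exact: measurable_funM.
have iX := (Lfun1_integrable P X).1 X1.
have iY := (Lfun1_integrable P Y).1 Y1.
have iXY := (Lfun1_integrable P _).1 XY1.
(* A product measure is determined on rectangles, where the claim is independence of the events X in
   A and Y in B. *)
have prodE C : measurable C ->
    (distribution P Xm \x distribution P Ym) C = distribution P XYm C.
  apply: product_measure_unique => A B mA mB.
  rewrite /= /distribution /= /pushforward /=.
  rewrite -i12; first by [].
    by rewrite -[X in <<s _ >> X]setTI; exact: sX.
  by rewrite -[X in <<s _ >> X]setTI; exact: sY.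
have mf' : measurable_fun [set: (R * R)%type] (fun z => `|f z|).
  exact: measurableT_comp.
have eqf (g : R * R -> \bar R) :
    \int[distribution P Xm \x distribution P Ym]_z g z =
    \int[distribution P XYm]_z g z.
  by apply: eq_measure_integral => A mA _; first [exact: prodE | exact/esym/prodE].
have idf : (distribution P Xm \x distribution P Ym).-integrable setT f.
  apply/integrableP; split=> //.
  rewrite eqf ge0_integral_distribution//.
  by have /integrableP[] := iXY.
rewrite unlock.
transitivity (\int[distribution P XYm]_z f z).
  by rewrite integral_distribution.
rewrite -eqf -integral12_prod_meas1//.
transitivity (\int[distribution P Xm]_x (x%:E * 'E_P[Y])).
  apply: eq_integral => x _; rewrite /f /= /fubini_F.
  under eq_integral do rewrite EFinM.
  rewrite integralZl//.
    congr (_ * _); rewrite unlock [LHS](@integral_distribution _ _ _ _ _ _ Ym EFin)//.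
  by apply: integrable_pushforward => //=; exact: EFin_measurable.
rewrite -(fineK (expectation_fin_num Y1)) integralZr//; last first.
  by apply: integrable_pushforward => //=; exact: EFin_measurable.
rewrite (fineK (expectation_fin_num Y1)) unlock.
by rewrite [X in X * _ = _](@integral_distribution _ _ _ _ _ _ Xm EFin).
Qed.

End Independence.

(** * Second-order random vectors *)

Section Cross.
Context d (T : measurableType d) (R : realType) (P : probability T R).

Lemma Lfun2_sub1 (f : T -> R) : f \in Lfun P 2%:E -> f \in Lfun P 1.
Proof. by apply: Lfun_subset12; exact: fin_num_measure. Qed.

Lemma Lfun2D (f g : T -> R) :
  f \in Lfun P 2%:E -> g \in Lfun P 2%:E -> f \+ g \in Lfun P 2%:E.
Proof. by move=> f2 g2; apply: (Lfun_addr_closed P _).2 => //; rewrite lee1n. Qed.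

Lemma Lfun2Z (a : R) (f : T -> R) :
  f \in Lfun P 2%:E -> (fun w => a * f w) \in Lfun P 2%:E.
Proof.
move=> f2; rewrite (_ : (fun w => a * f w) = a \o* f).
  by apply: Lfun_scale => //; rewrite ler1n.
by apply/funext => w /=; rewrite mulrC.
Qed.

Lemma Lfun2_sum (I : Type) (s : seq I) (F : I -> T -> R) :
  (forall i, F i \in Lfun P 2%:E) ->
  (fun w => \sum_(i <- s) F i w) \in Lfun P 2%:E.
Proof.
move=> F2; elim: s => [|i s IHs].
  by under eq_fun do rewrite big_nil; exact: Lfun_cst.
under eq_fun do rewrite big_cons.
exact: Lfun2D.
Qed.

(** A constant vector becomes [mxapp a const1] and a mean becomes [cross X const1], so affine terms
    obey the same bilinear rules as the observations. *)
Definition const1 : T -> 'cV[R]_1 := fun=> const_mx 1.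


Definition mxapp m n (A : 'M[R]_(m, n)) (X : T -> 'cV[R]_n) : T -> 'cV[R]_m :=
  fun w => A *m X w.

Definition cross m n (X : T -> 'cV[R]_m) (Y : T -> 'cV[R]_n) : 'M[R]_(m, n) :=
  Emx P (fun w => X w *m (Y w)^T).

Lemma second_order_const1 : second_order P const1.
Proof.
by move=> i; rewrite (_ : coord_rv _ _ = cst 1) ?Lfun_cst//; apply/funext => w;
  rewrite /coord_rv mxE.
Qed.

Lemma second_orderD n (X Y : T -> 'cV[R]_n) :
  second_order P X -> second_order P Y -> second_order P (X + Y).
Proof.
move=> X2 Y2 i; rewrite (_ : coord_rv _ _ = coord_rv X i \+ coord_rv Y i).
  exact: Lfun2D.
by apply/funext => w; rewrite /coord_rv /= mxE.
Qed.

Lemma second_order_mxapp m n (A : 'M[R]_(m, n)) (X : T -> 'cV[R]_n) :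
  second_order P X -> second_order P (mxapp A X).
Proof.
move=> X2 i; rewrite (_ : coord_rv _ _ = fun w => \sum_k A i k * coord_rv X k w).
  by apply: Lfun2_sum => k; exact: Lfun2Z.
by apply/funext => w; rewrite /coord_rv mxE.
Qed.

Lemma second_orderN n (X : T -> 'cV[R]_n) : second_order P X -> second_order P (- X).
Proof.
move=> X2 i; rewrite (_ : coord_rv _ _ = fun w => -1 * coord_rv X i w).
  exact: Lfun2Z.
by apply/funext => w; rewrite /coord_rv /= mxE mulN1r.
Qed.

Lemma second_orderB n (X Y : T -> 'cV[R]_n) :
  second_order P X -> second_order P Y -> second_order P (X - Y).
Proof. by move=> X2 Y2; apply: second_orderD => //; exact: second_orderN. Qed.

Lemma second_order0 n : second_order P (0 : T -> 'cV[R]_n).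
Proof.
move=> i; rewrite (_ : coord_rv _ _ = cst 0) ?Lfun_cst//.
by apply/funext => w; rewrite /coord_rv /= mxE.
Qed.

Lemma second_order_sum n (I : Type) (s : seq I) (F : I -> T -> 'cV[R]_n)
    (p : pred I) : (forall i, p i -> second_order P (F i)) ->
  second_order P (\sum_(i <- s | p i) F i).
Proof.
move=> F2; elim/big_rec: _ => [|i X pi X2]; first exact: second_order0.
by apply: second_orderD => //; exact: F2.
Qed.

Lemma crossE m n (X : T -> 'cV[R]_m) (Y : T -> 'cV[R]_n) i j :
  cross X Y i j = fine 'E_P[coord_rv X i \* coord_rv Y j]%E.
Proof.
rewrite mxE; congr (fine 'E_P[_])%E; apply/funext => w.
by rewrite mxE big_ord1 mxE.
Qed.

Lemma cross_mean n (X : T -> 'cV[R]_n) : cross X const1 = Emx P X.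
Proof.
apply/matrixP => i j; rewrite crossE mxE; congr (fine 'E_P[_])%E.
by apply/funext => w; rewrite /coord_rv /= !mxE mulr1 (ord1 j).
Qed.

Lemma cross_tr m n (X : T -> 'cV[R]_m) (Y : T -> 'cV[R]_n) :
  (cross X Y)^T = cross Y X.
Proof.
apply/matrixP => i j; rewrite mxE !crossE; congr (fine 'E_P[_])%E.
by apply/funext => w; rewrite /= mulrC.
Qed.

Lemma coord_mul_Lfun1 m n (X : T -> 'cV[R]_m) (Y : T -> 'cV[R]_n) i j :
  second_order P X -> second_order P Y ->
  coord_rv X i \* coord_rv Y j \in Lfun P 1.
Proof. by move=> X2 Y2; exact: Lfun2_mul_Lfun1. Qed.

Lemma crossDl m n (X Y : T -> 'cV[R]_m) (Z : T -> 'cV[R]_n) :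
  second_order P X -> second_order P Y -> second_order P Z ->
  cross (X + Y) Z = cross X Z + cross Y Z.
Proof.
move=> X2 Y2 Z2; apply/matrixP => i j; rewrite crossE [RHS]mxE !crossE.
have XZ := coord_mul_Lfun1 i j X2 Z2; have YZ := coord_mul_Lfun1 i j Y2 Z2.
rewrite -fineD ?expectation_fin_num// -expectationD//.
congr (fine 'E_P[_])%E; apply/funext => w.
by rewrite /coord_rv /= mxE mulrDl.
Qed.

(** Integrability of the partial sums is carried along because additivity of expectation requires it
    at each step of the induction. *)
Lemma fine_expectation_sum (I : Type) (s : seq I) (F : I -> T -> R) :
  (forall i, F i \in Lfun P 1) ->
  (fun w => \sum_(i <- s) F i w) \in Lfun P 1 /\
  fine 'E_P[fun w => (\sum_(i <- s) F i w)%R]%E = \sum_(i <- s) fine 'E_P[F i]%E.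
Proof.
move=> F1; elim: s => [|i s [s1 IHs]].
  under eq_fun do rewrite big_nil.
  by rewrite big_nil expectation_cst; split=> //; exact: Lfun_cst.
under eq_fun do rewrite big_cons.
split; first by apply: (Lfun_addr_closed P _).2.
rewrite big_cons -IHs -fineD ?expectation_fin_num// -expectationD//.
Qed.

Lemma fine_expectationZ (a : R) (f : T -> R) : f \in Lfun P 1 ->
  fine 'E_P[fun w => (a * f w)%R]%E = a * fine 'E_P[f]%E.
Proof.
move=> f1; rewrite (_ : (fun w => a * f w) = a \o* f).
  by rewrite expectationZl// fineM// expectation_fin_num.
by apply/funext => w /=; rewrite mulrC.
Qed.

Lemma cross_mull m n p (A : 'M[R]_(p, m)) (X : T -> 'cV[R]_m) (Z : T -> 'cV[R]_n) :
  second_order P X -> second_order P Z ->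
  cross (mxapp A X) Z = A *m cross X Z.
Proof.
move=> X2 Z2; apply/matrixP => i j; rewrite crossE mxE.
have XZ k := coord_mul_Lfun1 k j X2 Z2.
rewrite (_ : _ \* _ =
    fun w => \sum_k A i k * (coord_rv X k \* coord_rv Z j) w).
  rewrite (fine_expectation_sum _ _).2 => [|k].
    by apply: eq_bigr => k _; rewrite fine_expectationZ// crossE.
  rewrite (_ : (fun w => _) = A i k \o* (coord_rv X k \* coord_rv Z j)).
    exact: Lfun_scale.
  by apply/funext => w /=; rewrite mulrC.
apply/funext => w; rewrite /coord_rv /= mxE mulr_suml.
by apply: eq_bigr => k _; rewrite mulrA.
Qed.

Lemma crossNl m n (X : T -> 'cV[R]_m) (Z : T -> 'cV[R]_n) :
  second_order P X -> second_order P Z -> cross (- X) Z = - cross X Z.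
Proof.
move=> X2 Z2; have -> : - X = mxapp (-1%:M) X.
  by apply/funext => w; rewrite /mxapp mulNmx mul1mx.
by rewrite cross_mull// mulNmx mul1mx.
Qed.

Lemma crossBl m n (X Y : T -> 'cV[R]_m) (Z : T -> 'cV[R]_n) :
  second_order P X -> second_order P Y -> second_order P Z ->
  cross (X - Y) Z = cross X Z - cross Y Z.
Proof.
move=> X2 Y2 Z2; rewrite crossDl ?crossNl//; exact: second_orderN.
Qed.

Lemma crossDr m n (Z : T -> 'cV[R]_m) (X Y : T -> 'cV[R]_n) :
  second_order P X -> second_order P Y -> second_order P Z ->
  cross Z (X + Y) = cross Z X + cross Z Y.
Proof. by move=> *; rewrite -cross_tr crossDl// linearD/= !cross_tr. Qed.

Lemma cross_mulr m n p (A : 'M[R]_(p, n)) (Z : T -> 'cV[R]_m) (X : T -> 'cV[R]_n) :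
  second_order P X -> second_order P Z ->
  cross Z (mxapp A X) = cross Z X *m A^T.
Proof. by move=> *; rewrite -cross_tr cross_mull// trmx_mul !cross_tr. Qed.

Lemma cross0l m n (Z : T -> 'cV[R]_n) : cross (0 : T -> 'cV[R]_m) Z = 0.
Proof.
apply/matrixP => i j; rewrite crossE mxE.
rewrite (_ : _ \* _ = cst 0) ?expectation_cst//.
by apply/funext => w; rewrite /coord_rv /= mxE mul0r.
Qed.

Lemma cross0r m n (Z : T -> 'cV[R]_n) : cross Z (0 : T -> 'cV[R]_m) = 0.
Proof. by rewrite -cross_tr cross0l trmx0. Qed.

Definition aeeq n (X Y : T -> 'cV[R]_n) : Prop := {ae P, forall w, X w = Y w}.

Lemma cross_aer m n (Z : T -> 'cV[R]_m) (X Y : T -> 'cV[R]_n) :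
  second_order P X -> second_order P Y -> second_order P Z ->
  aeeq X Y -> cross Z X = cross Z Y.
Proof.
move=> X2 Y2 Z2 XY; apply/matrixP => i j; rewrite !crossE; congr fine.
have /Lfun1_integrable/integrableP[mX _] := coord_mul_Lfun1 i j Z2 X2.
have /Lfun1_integrable/integrableP[mY _] := coord_mul_Lfun1 i j Z2 Y2.
rewrite unlock; apply: ae_eq_integral => //.
by apply: filterS XY => w XYw _; rewrite /coord_rv /= XYw.
Qed.

Lemma cross_ael m n (Z : T -> 'cV[R]_m) (X Y : T -> 'cV[R]_n) :
  second_order P X -> second_order P Y -> second_order P Z ->
  aeeq X Y -> cross X Z = cross Y Z.
Proof.
move=> X2 Y2 Z2 XY; rewrite -cross_tr (cross_aer X2 Y2 Z2 XY) cross_tr//.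
Qed.

(** The diagonal entries are E[X_i^2], so each of the finitely many coordinates vanishes almost
    surely. *)
Lemma cross_self0 n (X : T -> 'cV[R]_n) :
  second_order P X -> cross X X = 0 -> {ae P, forall w, X w = 0}.
Proof.
move=> X2 XX0.
have X0 i : {ae P, forall w, X w i ord0 = 0}.
  have := congr1 (fun M : 'M[R]_(n, n) => M i i) XX0; rewrite /= crossE [RHS]mxE.
  have XX1 := coord_mul_Lfun1 i i X2 X2.
  have iXX := (Lfun1_integrable P _).1 XX1.
  move=> E0.
  have I0 : 'E_P[coord_rv X i \* coord_rv X i]%E = 0%E.
    by rewrite -[LHS]fineK ?expectation_fin_num// E0.
  rewrite unlock in I0.
  have mXX := measurable_int P iXX.
  have : (\int[P]_w `|(coord_rv X i w * coord_rv X i w)%:E| = 0)%E.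
    rewrite -[RHS]I0; apply: eq_integral => w _.
    by rewrite gee0_abs// lee_fin -expr2 sqr_ge0.
  move/(ae_eq_integral_abs P measurableT mXX).
  apply: filterS => w /(_ Logic.I) /= [] /eqP.
  by rewrite mulf_eq0 orbb => /eqP.
have := filter_forall (ae_filter_ringOfSetsType P) X0.
apply: filterS => w Xw; apply/matrixP => i j.
by rewrite (ord1 j) Xw mxE.
Qed.

End Cross.
Arguments const1 {d T R} _.

(** * Orthogonal projection on the observations *)

Section Span.
Context d (T : measurableType d) (R : realType) (P : probability T R).
Context (nz : nat) (y : nat -> T -> 'cV[R]_nz).

Definition obs_comb L n (a : 'cV[R]_n) (c : nat -> 'M[R]_(n, nz)) :
    T -> 'cV[R]_n :=
  mxapp a const1 + \sum_(1 <= j < L.+1) mxapp (c j) (y j).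

(** Matrix coefficients express all coordinates at once. Equality is almost sure because estimators
    are determined only up to null sets. *)
Definition inspan L n (Z : T -> 'cV[R]_n) : Prop :=
  exists a c, aeeq P Z (obs_comb L a c).

Definition orth_span L n (X : T -> 'cV[R]_n) : Prop :=
  cross P X const1 = 0 /\
  forall j, (1 <= j <= L)%N -> cross P X (y j) = 0.

Lemma fct_sum_app (I : Type) (s : seq I) (p : pred I) n
    (F : I -> T -> 'cV[R]_n) (w : T) :
  (\sum_(i <- s | p i) F i) w = \sum_(i <- s | p i) F i w.
Proof. by elim/big_rec2: _ => // i a X _ <-. Qed.

Lemma obs_combE L n (a : 'cV[R]_n) c w :
  obs_comb L a c w = a + \sum_(1 <= j < L.+1) c j *m y j w.
Proof.
rewrite [LHS](_ : _ = mxapp a const1 w +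
  (\sum_(1 <= j < L.+1) mxapp (c j) (y j)) w)//.
rewrite fct_sum_app; congr (_ + _).
apply/matrixP => i j; rewrite /mxapp !mxE big_ord1 mxE mulr1.
by rewrite (ord1 j).
Qed.

Lemma inspanS L L' n (Z : T -> 'cV[R]_n) :
  (L <= L')%N -> inspan L Z -> inspan L' Z.
Proof.
move=> LL' [a [c Zac]]; exists a, (fun j => if (j <= L)%N then c j else 0).
apply: filterS Zac => w ->; rewrite !obs_combE; congr (_ + _).
rewrite [RHS](big_cat_nat (n := L.+1))//=.
have -> : \sum_(L.+1 <= j < L'.+1) (if (j <= L)%N then c j else 0) *m y j w = 0.
  rewrite big_nat; apply: big1 => j /andP[Lj _].
  by rewrite leqNgt Lj mul0mx.
rewrite addr0 big_nat [RHS]big_nat; apply: eq_bigr => j /andP[_ jL].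
by rewrite -ltnS jL.
Qed.

Lemma inspanD L n (X Y : T -> 'cV[R]_n) :
  inspan L X -> inspan L Y -> inspan L (X + Y).
Proof.
move=> [a [c h]] [a' [c' h']]; exists (a + a'), (fun j => c j + c' j).
apply: filterS2 h h' => w Xw Yw.
rewrite [LHS](_ : _ = X w + Y w)// Xw Yw !obs_combE addrACA -big_split/=.
by congr (_ + _); apply: eq_bigr => j _; rewrite mulmxDl.
Qed.

Lemma inspan_mxapp L m n (A : 'M[R]_(m, n)) (X : T -> 'cV[R]_n) :
  inspan L X -> inspan L (mxapp A X).
Proof.
move=> [a [c h]]; exists (A *m a), (fun j => A *m c j).
apply: filterS h => w Xw; rewrite /mxapp Xw !obs_combE mulmxDr mulmx_sumr.
by congr (_ + _); apply: eq_bigr => j _; rewrite mulmxA.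
Qed.

Lemma inspanB L n (X Y : T -> 'cV[R]_n) :
  inspan L X -> inspan L Y -> inspan L (X - Y).
Proof.
move=> hX hY; apply: inspanD => //.
have -> : - Y = mxapp (-1%:M) Y.
  by apply/funext => w; rewrite /mxapp mulNmx mul1mx.
exact: inspan_mxapp.
Qed.

Lemma inspan_const1 L : inspan L const1.
Proof.
exists (const_mx 1), (fun=> 0); apply: nearW => w; rewrite obs_combE.
by rewrite big1 ?addr0// => j _; rewrite mul0mx.
Qed.

Lemma inspan0 L n : inspan L (0 : T -> 'cV[R]_n).
Proof.
exists 0, (fun=> 0); apply: nearW => w; rewrite obs_combE.
by rewrite big1 ?addr0// => j _; rewrite mul0mx.
Qed.

Lemma inspan_obs L j : (1 <= j <= L)%N -> inspan L (y j).
Proof.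
move=> jL; exists 0, (fun k => if k == j then 1%:M else 0).
apply: nearW => w; rewrite obs_combE add0r.
rewrite (bigD1_seq j) ?iota_uniq//=; last by rewrite mem_index_iota ltnS.
rewrite eqxx mul1mx big1 ?addr0// => k /negPf ->.
by rewrite mul0mx.
Qed.

Lemma second_order_comb L n (a : 'cV[R]_n) c :
  (forall j, (1 <= j <= L)%N -> second_order P (y j)) ->
  second_order P (obs_comb L a c).
Proof.
move=> y2; apply: second_orderD.
  by apply: second_order_mxapp; exact: second_order_const1.
rewrite big_nat; apply: second_order_sum => j; rewrite ltnS => jL.
by apply: second_order_mxapp; exact: y2.
Qed.

Lemma orth_spanP L m n (X : T -> 'cV[R]_m) (Z : T -> 'cV[R]_n) :
  (forall j, (1 <= j <= L)%N -> second_order P (y j)) ->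
  second_order P X -> second_order P Z ->
  orth_span L X -> inspan L Z -> cross P X Z = 0.
Proof.
move=> y2 X2 Z2 [X1 Xy] [a [c Zac]].
have C2 := second_order_comb a c y2.
rewrite (cross_aer Z2 C2 X2 Zac) /obs_comb.
have o2 := second_order_const1 P.
rewrite crossDr//; first last.
- rewrite big_nat; apply: second_order_sum => j; rewrite ltnS => jL.
  by apply: second_order_mxapp; exact: y2.
- exact: second_order_mxapp.
rewrite cross_mulr// X1 mul0mx add0r big_nat.
set s := \sum_(1 <= j < L.+1 | _) _.
(* Square integrability of the partial sum travels with orthogonality, since bilinearity of [cross]
   needs it. *)
suff [] : second_order P s /\ cross P X s = 0 by [].
rewrite /s; elim/big_rec: _ => [|j Y].
  by split; [exact: second_order0|exact: cross0r].
rewrite ltnS => jL [Y2 XY].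
have yj2 := y2 _ jL; have cy2 := second_order_mxapp (c j) yj2.
split; first exact: second_orderD.
by rewrite crossDr// XY addr0 cross_mulr// Xy// mul0mx.
Qed.

(** Passage from the coordinatewise definition to matrix form: coefficient rows chosen separately
    for each coordinate are stacked, and orthogonality is tested against 1 and the coordinates of
    each y_j. *)
Lemma LS_estimatorP L n (zeta zh : T -> 'cV[R]_n) :
  (forall j, (1 <= j <= L)%N -> second_order P (y j)) ->
  second_order P zeta ->
  LS_estimator P y L zeta zh ->
  [/\ second_order P zh, inspan L zh & orth_span L (zeta - zh)].
Proof.
move=> y2 z2 h.
have zh2 : second_order P zh by move=> i; have [[]] := h i.
have orthc g : obs_span P y L g -> forall i,
    fine 'E_P[coord_rv (zeta - zh)%R i \* g]%E = 0.
  move=> gspan i; have [_ /(_ _ gspan)] := h i.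
  rewrite (_ : coord_rv zeta i \- coord_rv zh i = coord_rv (zeta - zh) i).
    by move=> ->.
  by apply/funext => w; rewrite /coord_rv /= !mxE.
split=> //.
- have hi i : exists ac : R * (nat -> 'rV[R]_nz), {ae P, forall w, zh w i ord0 =
      ac.1 + \sum_(1 <= j < L.+1) (ac.2 j *m y j w) ord0 ord0}.
    by have [[_ [a [c hac]]] _] := h i; exists (a, c).
  have [ac hac] := choice hi.
  exists (\col_i (ac i).1), (fun j => \matrix_(i, k) (ac i).2 j ord0 k).
  have := filter_forall (ae_filter_ringOfSetsType P) hac.
  apply: filterS => w hw; rewrite obs_combE; apply/matrixP => i j.
  rewrite (ord1 j) hw !mxE summxE; congr (_ + _); apply: eq_bigr => k _.
  by rewrite !mxE; apply: eq_bigr => l _; rewrite mxE.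
- split.
    apply/matrixP => i j; rewrite crossE mxE; apply: orthc; split.
      exact: second_order_const1.
    exists 1, (fun=> 0); apply: nearW => w; rewrite /coord_rv mxE.
    by rewrite big1 ?addr0// => k _; rewrite mul0mx mxE.
  move=> j jL; apply/matrixP => i k; rewrite crossE mxE; apply: orthc; split.
    exact: y2.
  (* The k-th coordinate of y_j is the combination with the single coefficient row
     [delta_mx 0 k]. *)
  exists 0, (fun l => if l == j then delta_mx 0 k else 0).
  apply: nearW => w; rewrite add0r.
  rewrite (bigD1_seq j) ?iota_uniq//=; last by rewrite mem_index_iota ltnS.
  rewrite eqxx -rowE mxE big1 ?addr0// => l /negPf ->.
  by rewrite mul0mx mxE.
Qed.

(** The difference of the two candidates lies in the span and is orthogonal to it, hence has zero
    second moment. *)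
Lemma projection_unique L n (zeta Z Z' : T -> 'cV[R]_n) :
  (forall j, (1 <= j <= L)%N -> second_order P (y j)) ->
  second_order P zeta -> second_order P Z -> second_order P Z' ->
  inspan L Z -> inspan L Z' ->
  orth_span L (zeta - Z) -> orth_span L (zeta - Z') -> aeeq P Z Z'.
Proof.
move=> y2 z2 Z2 Z2' sZ sZ' oZ oZ'.
have D2 := second_orderB Z2 Z2'.
have sD := inspanB sZ sZ'.
have r2 := second_orderB z2 Z2; have r2' := second_orderB z2 Z2'.
have E : Z - Z' = (zeta - Z') - (zeta - Z) by rewrite opprB [RHS]addrC addrA subrK.
have : cross P (Z - Z') (Z - Z') = 0.
  rewrite {1}E crossBl// (orth_spanP y2 r2' D2 oZ' sD).
  by rewrite (orth_spanP y2 r2 D2 oZ sD) subr0.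
move/(cross_self0 D2); apply: filterS => w /eqP.
by rewrite subr_eq0 => /eqP.
Qed.

End Span.

(** * Independent random vectors *)

Section IndepVectors.
Context d (T : measurableType d) (R : realType) (P : probability T R).

Definition gmeas (G : set_system T) (X : T -> R) : Prop :=
  measurable_fun setT (X : g_sigma_algebraType G -> R).

Definition rvmeas (G : set_system T) n (X : T -> 'cV[R]_n) : Prop :=
  forall i, gmeas G (coord_rv X i).

Definition scalef n (s : T -> R) (X : T -> 'cV[R]_n) : T -> 'cV[R]_n :=
  fun w => s w *: X w.

Lemma gmeasS (G H : set_system T) (X : T -> R) :
  G `<=` <<s H >> -> gmeas G X -> gmeas H X.
Proof.
move=> GH mX _ B mB; have := mX measurableT B mB.
exact: (smallest_sub (smallest_sigma_algebra _ _) GH).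
Qed.

Lemma rvmeasS (G H : set_system T) n (X : T -> 'cV[R]_n) :
  G `<=` <<s H >> -> rvmeas G X -> rvmeas H X.
Proof. by move=> GH mX i; exact: gmeasS (mX i). Qed.

Lemma rvmeasD G n (X Y : T -> 'cV[R]_n) :
  rvmeas G X -> rvmeas G Y -> rvmeas G (X + Y).
Proof.
move=> mX mY i; rewrite (_ : coord_rv _ _ = coord_rv X i \+ coord_rv Y i).
  by apply: (@measurable_funD _ (g_sigma_algebraType G) R setT); [exact: mX|exact: mY].
by apply/funext => w; rewrite /coord_rv /= mxE.
Qed.

Lemma rvmeas_mxapp G m n (A : 'M[R]_(m, n)) (X : T -> 'cV[R]_n) :
  rvmeas G X -> rvmeas G (mxapp A X).
Proof.
move=> mX i; rewrite (_ : coord_rv _ _ = fun w => \sum_k A i k * coord_rv X k w).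
  elim: (index_enum _) => [|k s IHs].
    by under eq_fun do rewrite big_nil; exact: measurable_cst.
  under eq_fun do rewrite big_cons.
  by apply: (@measurable_funD _ (g_sigma_algebraType G) R setT) => //;
    apply: (@measurable_funM _ (g_sigma_algebraType G) R setT);
    [exact: measurable_cst|exact: mX].
by apply/funext => w; rewrite /coord_rv mxE.
Qed.

Lemma rvmeas_scalef G n (s : T -> R) (X : T -> 'cV[R]_n) :
  gmeas G s -> rvmeas G X -> rvmeas G (scalef s X).
Proof.
move=> ms mX i; rewrite (_ : coord_rv _ _ = s \* coord_rv X i).
  by apply: (@measurable_funM _ (g_sigma_algebraType G) R setT); [exact: ms|exact: mX].
by apply/funext => w; rewrite /coord_rv mxE.
Qed.

Lemma rvmeas_const1 G : rvmeas G const1.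
Proof.
move=> i; rewrite (_ : coord_rv _ _ = cst 1); first exact: measurable_cst.
by apply/funext => w; rewrite /coord_rv mxE.
Qed.

Lemma rvmeasN G n (X : T -> 'cV[R]_n) : rvmeas G X -> rvmeas G (- X).
Proof.
move=> mX; have -> : - X = mxapp (-1%:M) X.
  by apply/funext => w; rewrite /mxapp mulNmx mul1mx.
exact: rvmeas_mxapp.
Qed.

(** Almost surely s is 0 or 1, so |s f| <= |f|. The exponent is 2 for random vectors and 1 for
    products of two coordinates. *)
Lemma bernoulli_mul_Lfun (s f : T -> R) (r : R) :
  1 <= r -> bernoulli_rv P s -> f \in Lfun P r%:E -> s \* f \in Lfun P r%:E.
Proof.
move=> r1 [ms s01]; rewrite !inE => /andP[]; rewrite !inE/= => mf.
rewrite /finite_norm => lf; apply/andP; split; rewrite inE/=.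
  exact: measurable_funM.
have r0 : 0 < r by exact: lt_le_trans r1.
move: lf; rewrite /finite_norm unlock /Lnorm => lf.
apply: poweR_lty; apply: le_lt_trans (lty_poweRy _ lf); last first.
  by rewrite invr_eq0 gt_eqF.
apply: ae_ge0_le_integral => //.
- by move=> w _; rewrite lee_fin powR_ge0.
- apply/measurable_EFinP.
  apply: (measurableT_comp (measurable_powR _)) => //.
  by apply: measurableT_comp => //; exact: measurable_funM.
- by move=> w _; rewrite lee_fin powR_ge0.
- apply/measurable_EFinP.
  apply: (measurableT_comp (measurable_powR _)) => //.
  exact: measurableT_comp.
- apply: filterS s01 => w sw _; rewrite lee_fin /=.
  apply: ge0_ler_powR; rewrite ?nnegrE//; first exact: ltW.
  by case: sw => ->; rewrite ?mul0r ?normr0// mul1r.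
Qed.

Lemma bernoulli_Lfun2 (s : T -> R) : bernoulli_rv P s -> s \in Lfun P 2%:E.
Proof.
move=> bs; rewrite (_ : s = s \* cst 1).
  by apply: bernoulli_mul_Lfun; rewrite ?ler1n//; exact: Lfun_cst.
by apply/funext => w /=; rewrite mulr1.
Qed.

Lemma second_order_scalef n (s : T -> R) (X : T -> 'cV[R]_n) :
  bernoulli_rv P s -> second_order P X -> second_order P (scalef s X).
Proof.
move=> bs X2 i; rewrite (_ : coord_rv _ _ = s \* coord_rv X i).
  by apply: bernoulli_mul_Lfun; rewrite ?ler1n//; exact: X2.
by apply/funext => w; rewrite /coord_rv mxE.
Qed.

(** [X] and [Y] may depend on each other: s is independent of the pair, hence of each product of
    their coordinates. *)
Lemma cross_scalef (G1 G2 : set_system T) m n (s : T -> R)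
    (X : T -> 'cV[R]_m) (Y : T -> 'cV[R]_n) :
  G1 `<=` measurable -> G2 `<=` measurable -> indep P G1 G2 ->
  gmeas G1 s -> bernoulli_rv P s -> rvmeas G2 X -> rvmeas G2 Y ->
  second_order P X -> second_order P Y ->
  cross P (scalef s X) Y = fine 'E_P[s]%E *: cross P X Y.
Proof.
move=> mG1 mG2 i12 ms bs mX mY X2 Y2; apply/matrixP => i j.
rewrite crossE [RHS]mxE crossE.
have XY1 := coord_mul_Lfun1 i j X2 Y2.
have s1 := Lfun2_sub1 (bernoulli_Lfun2 bs).
rewrite -fineM ?expectation_fin_num//.
rewrite -(expectation_indep mG1 mG2 i12)//.
- congr (fine 'E_P[_])%E; apply/funext => w.
  by rewrite /coord_rv /= mxE mulrA.
- by apply: (@measurable_funM _ (g_sigma_algebraType G2) R setT); [exact: mX|exact: mY].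
- exact: bernoulli_mul_Lfun.
Qed.

Lemma cross_indep (G1 G2 : set_system T) m n
    (X : T -> 'cV[R]_m) (Y : T -> 'cV[R]_n) :
  G1 `<=` measurable -> G2 `<=` measurable -> indep P G1 G2 ->
  rvmeas G1 X -> rvmeas G2 Y -> second_order P X -> second_order P Y ->
  cross P X Y = Emx P X *m (Emx P Y)^T.
Proof.
move=> mG1 mG2 i12 mX mY X2 Y2; apply/matrixP => i j.
have X1 : coord_rv X i \in Lfun P 1 by exact: Lfun2_sub1.
have Y1 : coord_rv Y j \in Lfun P 1 by exact: Lfun2_sub1.
rewrite crossE [RHS]mxE big_ord_recl big_ord0 addr0 !mxE.
rewrite -fineM ?expectation_fin_num//.
rewrite -(expectation_indep mG1 mG2 i12 (mX i) (mY j))//.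
exact: coord_mul_Lfun1.
Qed.

Lemma sigma_of_algebra (I : Type) (D : set I) (X : I -> T -> R) :
  sigma_algebra setT (sigma_of D X).
Proof. exact: smallest_sigma_algebra. Qed.

Lemma sigma_of_measurable (I : Type) (D : set I) (X : I -> T -> R) :
  (forall i, D i -> measurable_fun setT (X i)) -> sigma_of D X `<=` measurable.
Proof.
move=> mX; apply: sigma_gen_measurable => A [i Di [B mB <-]].
exact: mX.
Qed.

Lemma gmeas_sigma_of (I : Type) (D : set I) (X : I -> T -> R) i :
  D i -> gmeas (sigma_of D X) (X i).
Proof.
move=> Di _ B mB; apply: sub_gen_smallest; apply: sub_gen_smallest.
by exists i => //; exists B.
Qed.

Lemma sigma_ofS (I : Type) (D D' : set I) (X : I -> T -> R) :
  D `<=` D' -> sigma_of D X `<=` sigma_of D' X.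
Proof.
move=> DD'; apply: sub_smallest2r; first exact: smallest_sigma_algebra.
by move=> A [i /DD' Di XA]; exists i.
Qed.

(* What c_L is independent of when the c_j are independent of each other and,
   jointly, of G. *)
Definition others (K : set nat) (c : nat -> T -> R) (L : nat)
    (G : set_system T) : set_system T :=
  \bigcup_(j in K `\ L) sigma_of [set j] c `|` G.

(** [c L] is independent of the other [c j], and the whole sequence is independent of [G];
    [indep_union] combines the two. *)
Lemma indep_others (K : set nat) (c : nat -> T -> R) (L : nat)
    (G : set_system T) :
  (forall k, K k -> measurable_fun setT (c k)) -> K L -> G `<=` measurable ->
  mutually_independent P K (fun k => sigma_of [set k] c) ->
  indep P (sigma_of K c) G ->
  indep P (sigma_of [set L] c) (others K c L G).
Proof.
move=> mc KL mG mic icG.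
have mcj j : K j -> sigma_of [set j] c `<=` measurable.
  by move=> Kj; apply: sigma_of_measurable => k ->; exact: mc.
apply: indep_union => //.
- exact: mcj.
- by move=> A [j [Kj _]]; exact: mcj.
- apply: (@mutually_independent_indep _ _ _ _ _ K (fun k => sigma_of [set k] c)) => //.
  + by move=> j _; exact: sigma_genT.
  + by move=> j _; exact: sigma_genI.
  + exact: sigma_of_algebra.
- apply: indepS icG; last exact: sub_gen_smallest.
  move=> A [|[j [Kj _]]] cA; apply: sub_gen_smallest; apply: sigma_ofS cA => k -> //.
Qed.

Lemma others_measurable (K : set nat) (c : nat -> T -> R) (L : nat)
    (G : set_system T) :
  (forall k, K k -> measurable_fun setT (c k)) -> G `<=` measurable ->
  others K c L G `<=` measurable.
Proof.
move=> mc mG A [[j [Kj _]]|/mG//].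
by apply: sigma_of_measurable => k ->; exact: mc.
Qed.

Lemma gmeas_others (K : set nat) (c : nat -> T -> R) (L j : nat) G :
  K j -> j <> L -> gmeas (others K c L G) (c j).
Proof.
move=> Kj jL; apply: (@gmeasS (sigma_of [set j] c)); last exact: gmeas_sigma_of.
by move=> A cA; apply: sub_gen_smallest; left; exists j.
Qed.

End IndepVectors.

(** * Second moments of the observation model *)

Section SystemFacts.
Context d (T : measurableType d) (R : realType) (P : probability T R).
Context (nx nz p : nat) (S : system R T nx nz p) (HS : assumptions P S).

Let K : set nat := [set k | (1 <= k)%N].

Let Fam : 'I_5 -> set_system T :=
  tnth [tuple sigma_process K (signal S); sigma_of K (gam S);
              sigma_process K (noise S); sigma_process K (attack S);
              sigma_of K (lam S)].

Let iX : 'I_5 := @Ordinal 5 0 isT.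
Let iG : 'I_5 := @Ordinal 5 1 isT.
Let iV : 'I_5 := @Ordinal 5 2 isT.
Let iW : 'I_5 := @Ordinal 5 3 isT.
Let iL : 'I_5 := @Ordinal 5 4 isT.

Let rest (i : 'I_5) : set_system T := \bigcup_(j in setT `\ i) Fam j.

Lemma noise_recE k : noise S k.+1 = mxapp (trans S k) (noise S k) + drive S k.
Proof. by apply/funext => w; rewrite (noise_rec HS). Qed.

Lemma noise_L2 k : second_order P (noise S k).
Proof.
elim: k => [|k IHk]; first exact: noise0_L2 HS.
rewrite noise_recE; apply: second_orderD; first exact: second_order_mxapp.
exact: drive_L2 HS k.
Qed.

Lemma second_order_measurable n (X : T -> 'cV[R]_n) i :
  second_order P X -> measurable_fun setT (coord_rv X i).
Proof. by move=> /(_ i); rewrite inE => /andP[]; rewrite inE. Qed.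

Lemma sigma_process_measurable (D : set nat) n (X : nat -> T -> 'cV[R]_n) :
  (forall k, D k -> second_order P (X k)) ->
  sigma_process D X `<=` measurable.
Proof.
move=> X2; apply: sigma_of_measurable => -[k i] /= Dk.
by apply: second_order_measurable; exact: X2.
Qed.

Lemma rvmeas_process (D : set nat) n (X : nat -> T -> 'cV[R]_n) k :
  D k -> rvmeas (sigma_process D X) (X k).
Proof.
move=> Dk i.
exact: (@gmeas_sigma_of _ _ _ _ _ (fun ki => coord_rv (X ki.1) ki.2) (k, i)).
Qed.

Lemma Fam_measurable j : Fam j `<=` measurable.
Proof.
case: j => -[|[|[|[|[|//]]]]] lj; rewrite /Fam (tnth_nth set0) /=.
- by apply: sigma_process_measurable => k; exact: signal_L2 HS k.
- by apply: sigma_of_measurable => k /(gam_bernoulli HS)[].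
- by apply: sigma_process_measurable => k _; exact: noise_L2.
- by apply: sigma_process_measurable => k; exact: attack_L2 HS k.
- by apply: sigma_of_measurable => k /(lam_bernoulli HS)[].
Qed.

Lemma Fam_sigma_algebra j : sigma_algebra setT (Fam j).
Proof.
by case: j => -[|[|[|[|[|//]]]]] lj; rewrite /Fam (tnth_nth set0) /=;
  exact: smallest_sigma_algebra.
Qed.

Lemma rest_measurable i : rest i `<=` measurable.
Proof. by move=> A [j _]; exact: Fam_measurable. Qed.

Lemma indep_rest i : indep P (Fam i) (rest i).
Proof.
apply: mutually_independent_indep => //.
- by move=> j _; exact: Fam_measurable.
- by move=> j _; rewrite -(sigma_algebra_id (Fam_sigma_algebra j)); exact: sigma_genT.
- by move=> j _; rewrite -(sigma_algebra_id (Fam_sigma_algebra j)); exact: sigma_genI.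
- exact: Fam_sigma_algebra.
- exact: processes_indep HS.
Qed.

Lemma rvmeas_Fam i n (X : T -> 'cV[R]_n) j :
  j <> i -> rvmeas (Fam j) X -> rvmeas (rest i) X.
Proof.
by move=> ji; apply: rvmeasS => A FA; apply: sub_gen_smallest; exists j.
Qed.

Lemma gmeas_Fam i (X : T -> R) j :
  j <> i -> gmeas (Fam j) X -> gmeas (rest i) X.
Proof.
by move=> ji; apply: gmeasS => A FA; apply: sub_gen_smallest; exists j.
Qed.

Lemma rvmeas_signal k : K k -> rvmeas (Fam iX) (signal S k).
Proof. by move=> Kk; exact: rvmeas_process. Qed.

Lemma rvmeas_noise k : K k -> rvmeas (Fam iV) (noise S k).
Proof. by move=> Kk; exact: rvmeas_process. Qed.

Lemma rvmeas_attack k : K k -> rvmeas (Fam iW) (attack S k).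
Proof. by move=> Kk; exact: rvmeas_process. Qed.

Lemma gmeas_gam k : K k -> gmeas (Fam iG) (gam S k).
Proof. by move=> Kk; exact: gmeas_sigma_of. Qed.

Lemma gmeas_lam k : K k -> gmeas (Fam iL) (lam S k).
Proof. by move=> Kk; exact: gmeas_sigma_of. Qed.

(** [restL L] omits lam_L but contains every gamma_k, so lam_L can be averaged out while gamma_L is
    still present; [restG L] omits gamma_L and contains every lam_k. *)
Let restL L := others K (lam S) L (rest iL).
Let restG L := others K (gam S) L (rest iG).

Lemma indep_lam L : K L -> indep P (sigma_of [set L] (lam S)) (restL L).
Proof.
move=> KL; apply: indep_others => //.
- by move=> k /(lam_bernoulli HS)[].
- exact: rest_measurable.
- exact: lam_indep HS.
- exact: (@indep_rest iL).
Qed.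

Lemma indep_gam L : K L -> indep P (sigma_of [set L] (gam S)) (restG L).
Proof.
move=> KL; apply: indep_others => //.
- by move=> k /(gam_bernoulli HS)[].
- exact: rest_measurable.
- exact: gam_indep HS.
- exact: (@indep_rest iG).
Qed.

Lemma lam_measurable k : K k -> sigma_of [set k] (lam S) `<=` measurable.
Proof.
by move=> Kk; apply: sigma_of_measurable => j -> ; case: (lam_bernoulli HS Kk).
Qed.

Lemma gam_measurable k : K k -> sigma_of [set k] (gam S) `<=` measurable.
Proof.
by move=> Kk; apply: sigma_of_measurable => j -> ; case: (gam_bernoulli HS Kk).
Qed.

Lemma restL_measurable L : restL L `<=` measurable.
Proof.
apply: others_measurable; last exact: rest_measurable.
by move=> k /(lam_bernoulli HS)[].
Qed.

Lemma restG_measurable L : restG L `<=` measurable.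
Proof.
apply: others_measurable; last exact: rest_measurable.
by move=> k /(gam_bernoulli HS)[].
Qed.

Lemma rest_others (c : nat -> T -> R) L (G : set_system T) :
  G `<=` <<s others K c L G >>.
Proof. by move=> A GA; apply: sub_gen_smallest; right. Qed.

Lemma cross_lam L m n (X : T -> 'cV[R]_m) (Y : T -> 'cV[R]_n) :
  K L -> rvmeas (restL L) X -> rvmeas (restL L) Y ->
  second_order P X -> second_order P Y ->
  cross P (scalef (lam S L) X) Y = lambar P S L *: cross P X Y.
Proof.
move=> KL mX mY X2 Y2.
apply: (cross_scalef (lam_measurable KL) (@restL_measurable L) (indep_lam KL)) => //.
- exact: gmeas_sigma_of.
- exact: lam_bernoulli HS L KL.
Qed.

Lemma cross_gam L m n (X : T -> 'cV[R]_m) (Y : T -> 'cV[R]_n) :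
  K L -> rvmeas (restG L) X -> rvmeas (restG L) Y ->
  second_order P X -> second_order P Y ->
  cross P (scalef (gam S L) X) Y = gambar P S L *: cross P X Y.
Proof.
move=> KL mX mY X2 Y2.
apply: (cross_scalef (gam_measurable KL) (@restG_measurable L) (indep_gam KL)) => //.
- exact: gmeas_sigma_of.
- exact: gam_bernoulli HS L KL.
Qed.

(** * Observations: decomposition, integrability and measurability *)

Let lin k : T -> 'cV[R]_nz :=
  mxapp (Hmx S k) (signal S k) + mxapp (Cvec S k) const1.

Lemma mxapp_const1 n (a : 'cV[R]_n) (w : T) : mxapp a (const1 (R := R)) w = a.
Proof. by apply/matrixP => i j; rewrite mxE big_ord1 mxE mulr1 (ord1 j). Qed.

Lemma zlinE k : zlin S k = scalef (gam S k) (lin k) + noise S k.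
Proof.
apply/funext => w.
by rewrite [RHS](_ : _ = gam S k w *: (Hmx S k *m signal S k w +
  mxapp (Cvec S k) const1 w) + noise S k w)// mxapp_const1.
Qed.

Lemma obsE k : obs S k = zlin S k - scalef (lam S k) (zlin S k)
                         + scalef (lam S k) (attack S k).
Proof. by apply/funext => w; rewrite /obs scalerBl scale1r. Qed.

Lemma lin_L2 k : K k -> second_order P (lin k).
Proof.
move=> Kk; apply: second_orderD; apply: second_order_mxapp.
  exact: signal_L2 HS k Kk.
exact: second_order_const1.
Qed.

Lemma zlin_L2 k : K k -> second_order P (zlin S k).
Proof.
move=> Kk; rewrite zlinE; apply: second_orderD; last exact: noise_L2.
apply: second_order_scalef; [exact: gam_bernoulli HS k Kk|exact: lin_L2].
Qed.

Lemma obs_L2 k : K k -> second_order P (obs S k).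
Proof.
move=> Kk; have z2 := zlin_L2 Kk; have bl := lam_bernoulli HS Kk.
rewrite obsE; apply: second_orderD.
  by apply: second_orderB => //; exact: second_order_scalef.
by apply: second_order_scalef => //; exact: attack_L2 HS k Kk.
Qed.

Lemma rvmeas_zlin G k : rvmeas G (signal S k) -> gmeas G (gam S k) ->
  rvmeas G (noise S k) -> rvmeas G (zlin S k).
Proof.
move=> mx mg mv; rewrite zlinE; apply: rvmeasD => //.
apply: rvmeas_scalef => //; apply: rvmeasD; apply: rvmeas_mxapp => //.
exact: rvmeas_const1.
Qed.

Lemma rvmeas_obs G k : rvmeas G (signal S k) -> gmeas G (gam S k) ->
  rvmeas G (noise S k) -> rvmeas G (attack S k) -> gmeas G (lam S k) ->
  rvmeas G (obs S k).
Proof.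
move=> mx mg mv mw ml; have mz := rvmeas_zlin mx mg mv.
rewrite obsE; apply: rvmeasD; last exact: rvmeas_scalef.
by apply: rvmeasD => //; apply: rvmeasN; exact: rvmeas_scalef.
Qed.

Lemma restL_vec L n (X : T -> 'cV[R]_n) j :
  j <> iL -> rvmeas (Fam j) X -> rvmeas (restL L) X.
Proof.
move=> jL mX; apply: (rvmeasS (@rest_others _ _ _)); exact: rvmeas_Fam mX.
Qed.

Lemma restG_vec L n (X : T -> 'cV[R]_n) j :
  j <> iG -> rvmeas (Fam j) X -> rvmeas (restG L) X.
Proof.
move=> jL mX; apply: (rvmeasS (@rest_others _ _ _)); exact: rvmeas_Fam mX.
Qed.

Lemma restL_gam L k : K k -> gmeas (restL L) (gam S k).
Proof.
move=> Kk; apply: (gmeasS (@rest_others _ _ _)).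
by apply: gmeas_Fam (gmeas_gam Kk).
Qed.

Lemma restG_lam L k : K k -> gmeas (restG L) (lam S k).
Proof.
move=> Kk; apply: (gmeasS (@rest_others _ _ _)).
by apply: gmeas_Fam (gmeas_lam Kk).
Qed.

Lemma restL_zlin L k : K k -> rvmeas (restL L) (zlin S k).
Proof.
move=> Kk; apply: rvmeas_zlin; last 1 first.
- by apply: restL_vec (rvmeas_noise Kk).
- by apply: restL_vec (rvmeas_signal Kk).
- exact: restL_gam.
Qed.

Lemma restL_obs L k : K k -> k <> L -> rvmeas (restL L) (obs S k).
Proof.
move=> Kk kL; apply: rvmeas_obs.
- by apply: restL_vec (rvmeas_signal Kk).
- exact: restL_gam.
- by apply: restL_vec (rvmeas_noise Kk).
- by apply: restL_vec (rvmeas_attack Kk).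
- exact: gmeas_others.
Qed.

Lemma restG_obs L k : K k -> k <> L -> rvmeas (restG L) (obs S k).
Proof.
move=> Kk kL; apply: rvmeas_obs.
- by apply: restG_vec (rvmeas_signal Kk).
- exact: gmeas_others.
- by apply: restG_vec (rvmeas_noise Kk).
- by apply: restG_vec (rvmeas_attack Kk).
- exact: restG_lam.
Qed.

(** The conditional mean of y_L given signal and noise; the attack drops out, being centred and
    independent of them and of lam_L. *)
Definition obs_mean L : T -> 'cV[R]_nz :=
  mxapp ((1 - lambar P S L)%:M)
    (mxapp (gambar P S L *: Hmx S L) (signal S L)
     + mxapp (gambar P S L *: Cvec S L) const1 + noise S L).

Lemma obs_mean_L2 L : K L -> second_order P (obs_mean L).
Proof.
move=> KL; apply: second_order_mxapp; apply: second_orderD; last exact: noise_L2.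
apply: second_orderD; apply: second_order_mxapp; first exact: signal_L2 HS L KL.
exact: second_order_const1.
Qed.

Lemma cross_obs_mean L n (Y : T -> 'cV[R]_n) : K L -> second_order P Y ->
  cross P (obs_mean L) Y = (1 - lambar P S L) *:
    (gambar P S L *: (Hmx S L *m cross P (signal S L) Y
                      + Cvec S L *m cross P const1 Y)
     + cross P (noise S L) Y).
Proof.
move=> KL Y2; have x2 := signal_L2 HS KL; have v2 := noise_L2 L.
have o2 := second_order_const1 P.
rewrite cross_mull//; last first.
  by do 2?[apply: second_orderD => //]; exact: second_order_mxapp.
rewrite mul_scalar_mx crossDl//; last first.
  by apply: second_orderD => //; exact: second_order_mxapp.
rewrite crossDl//; try exact: second_order_mxapp.
by rewrite !cross_mull// -!scalemxAl -scalerDr.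
Qed.

(** [Y] may involve all variables except lam_L and gamma_L. Orthogonality to the attack is a
    separate hypothesis because it has two sources: independence for signal and noise, whiteness for
    another observation. *)
Lemma cross_obs L n (Y : T -> 'cV[R]_n) :
  K L -> rvmeas (restL L) Y -> rvmeas (restG L) Y -> second_order P Y ->
  cross P (attack S L) Y = 0 -> cross P (obs S L - obs_mean L) Y = 0.
Proof.
move=> KL mLY mGY Y2 wY0.
have x2 := signal_L2 HS KL; have v2 := noise_L2 L; have w2 := attack_L2 HS KL.
have z2 := zlin_L2 KL; have bl := lam_bernoulli HS KL; have l2 := lin_L2 KL.
have bg := gam_bernoulli HS KL; have o2 := second_order_const1 P.
have sz2 := second_order_scalef bl z2; have sw2 := second_order_scalef bl w2.
have sl2 := second_order_scalef bg l2.
rewrite crossBl//; [|exact: obs_L2|exact: obs_mean_L2].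
rewrite cross_obs_mean// obsE crossDl//; last exact: second_orderB.
rewrite crossBl// !cross_lam//; first last.
- exact: restL_zlin.
- by apply: restL_vec (rvmeas_attack KL).
rewrite wY0 scaler0 addr0 zlinE crossDl// cross_gam//; last first.
  by apply: rvmeasD; apply: rvmeas_mxapp;
    [apply: restG_vec (rvmeas_signal KL)|exact: rvmeas_const1].
rewrite /lin crossDl//; try exact: second_order_mxapp.
by rewrite !cross_mull// [X in _ - X]scalerBl scale1r subrr.
Qed.

Lemma cross_rest i m n (X : T -> 'cV[R]_m) (Y : T -> 'cV[R]_n) :
  second_order P X -> second_order P Y -> rvmeas (Fam i) X -> rvmeas (rest i) Y ->
  Emx P X = 0 -> cross P X Y = 0.
Proof.
move=> X2 Y2 mX mY X0.
rewrite (cross_indep (@Fam_measurable i) (@rest_measurable i) (@indep_rest i))//.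
by rewrite X0 mul0mx.
Qed.

(** * Covariances of the signal and the noise *)

Lemma Covmx_cross m n (X : T -> 'cV[R]_m) (Y : T -> 'cV[R]_n) :
  Emx P X = 0 -> Emx P Y = 0 -> Covmx P X Y = cross P X Y.
Proof.
move=> X0 Y0; apply/matrixP => i j; rewrite crossE mxE.
have Xi : fine 'E_P[coord_rv X i]%E = 0.
  by have /matrixP/(_ i ord0) := X0; rewrite !mxE.
have Yj : fine 'E_P[coord_rv Y j]%E = 0.
  by have /matrixP/(_ j ord0) := Y0; rewrite !mxE.
rewrite covariance.unlock Xi Yj; congr (fine 'E_P[_])%E.
by apply/funext => w; rewrite !fctE /= !subr0.
Qed.

Lemma cross_signal_const1 k : K k -> cross P (signal S k) const1 = 0.
Proof. by move=> Kk; rewrite cross_mean; exact: signal_mean0 HS k Kk. Qed.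

Lemma cross_noise_const1 k : cross P (noise S k) const1 = 0.
Proof.
elim: k => [|k IHk]; first by rewrite cross_mean; exact: noise0_mean0 HS.
have v2 := noise_L2 k; have u2 := drive_L2 HS k.
have o2 := second_order_const1 P.
rewrite noise_recE crossDl//; last exact: second_order_mxapp.
by rewrite cross_mull// IHk mulmx0 add0r cross_mean; exact: drive_mean0 HS k.
Qed.

Lemma cross_signal s k : K s -> (s <= k)%N ->
  cross P (signal S k) (signal S s) = facA S k *m (facB S s)^T.
Proof.
move=> Ks sk; have Kk : K k := leq_trans Ks sk.
rewrite -Covmx_cross ?(signal_mean0 HS)//.
by apply: (signal_cov HS); rewrite sk andbT.
Qed.

Lemma cross_signal_noise j k : K j -> K k ->
  cross P (signal S j) (noise S k) = 0.
Proof.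
move=> Kj Kk; apply: (@cross_rest iX).
- exact: signal_L2 HS j Kj.
- exact: noise_L2.
- exact: rvmeas_signal.
- by apply: rvmeas_Fam (rvmeas_noise Kk).
- exact: signal_mean0 HS j Kj.
Qed.

Lemma cross_drive j k : j <> k -> cross P (drive S j) (drive S k) = 0.
Proof.
by move=> jk; rewrite -Covmx_cross ?(drive_mean0 HS)//; exact: drive_white HS j k jk.
Qed.

Lemma cross_noise0_drive j : cross P (noise S 0) (drive S j) = 0.
Proof.
have mv : sigma_process [set 0%N] (noise S) `<=` measurable.
  by apply: sigma_process_measurable => k _; exact: noise_L2.
have mu : sigma_process setT (drive S) `<=` measurable.
  by apply: sigma_process_measurable => k _; exact: drive_L2 HS k.
rewrite (@cross_indep _ _ _ P (sigma_process [set 0%N] (noise S))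
  (sigma_process setT (drive S)))//.
- by rewrite (noise0_mean0 HS) mul0mx.
- move=> A B; rewrite !sigma_algebra_id; try exact: smallest_sigma_algebra.
  move=> vA uB; have := drive_noise0_indep HS.
  move=> /(_ [fset true; false]%fset _ (fun b => if b then B else A)).
  rewrite big_fsetU1 ?inE//= big_seq_fset1 muleC => <- //; last by case.
  congr (P _); apply/seteqP; split=> [w [Aw Bw] []//|w h].
  by split; [apply: (h false)|apply: (h true)]; rewrite /= !inE.
- exact: rvmeas_process.
- exact: rvmeas_process.
- exact: noise0_L2 HS.
- exact: drive_L2 HS j.
Qed.

(** v_s is built from v_0 and u_0, ..., u_{s-1}, all uncorrelated with u_j once s <= j. *)
Lemma cross_noise_drive s j : (s <= j)%N -> cross P (noise S s) (drive S j) = 0.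
Proof.
elim: s => [|s IHs] sj; first exact: cross_noise0_drive.
have v2 := noise_L2 s; have u2 := drive_L2 HS.
rewrite noise_recE crossDl//; last exact: second_order_mxapp.
rewrite cross_mull// (IHs (ltnW sj)) mulmx0 add0r.
by apply: cross_drive => sj'; rewrite sj' ltnn in sj.
Qed.

Lemma cross_noise_self s : cross P (noise S s) (noise S s) = Sigma_v P S s.
Proof.
elim: s => [|s IHs].
  by rewrite /= Covmx_cross ?(noise0_mean0 HS).
have v2 := noise_L2 s; have u2 := drive_L2 HS s.
have Dv2 := second_order_mxapp (trans S s) v2.
rewrite noise_recE crossDl ?crossDr//; try exact: second_orderD.
have vu := cross_noise_drive (leqnn s).
have uv : cross P (drive S s) (noise S s) = 0 by rewrite -cross_tr vu trmx0.
rewrite !cross_mull// !cross_mulr// vu uv mulmx0 mul0mx addr0 add0r.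
by rewrite /= IHs mulmxA Covmx_cross ?(drive_mean0 HS).
Qed.

Lemma Emat_unit k : Emat S k \in unitmx.
Proof.
elim: k => [|k IHk] /=; first exact: unitmx1.
by rewrite unitmx_mul IHk (trans_unit HS).
Qed.

(** Induction on k - s: a further time step multiplies on the left by the transition matrix, the new
    drive being uncorrelated with v_s. *)
Lemma cross_noise s k : (s <= k)%N ->
  cross P (noise S k) (noise S s) = Emat S k *m (Fmat P S s)^T.
Proof.
move=> sk; rewrite -(subnK sk); elim: (k - s)%N => [|t IHt].
  (* Base case: E_s F_s^T = E_s E_s^{-1} (Sigma^v_s)^T, and Sigma^v_s is symmetric as the second
     moment of v_s. *)
  rewrite add0n cross_noise_self /Fmat trmx_mul trmxK mulmxA.
  by rewrite mulmxV ?Emat_unit// mul1mx -cross_noise_self cross_tr.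
have v2 := noise_L2; have u2 := drive_L2 HS (t + s)%N.
rewrite addSn noise_recE crossDl//; last exact: second_order_mxapp.
rewrite cross_mull// IHt mulmxA.
by rewrite -(cross_tr P (noise S s)) cross_noise_drive ?leq_addl// trmx0 addr0.
Qed.

Lemma cross_attack L n (Y : T -> 'cV[R]_n) : K L -> second_order P Y ->
  rvmeas (rest iW) Y -> cross P (attack S L) Y = 0.
Proof.
move=> KL Y2 mY; apply: (@cross_rest iW) => //.
- exact: attack_L2 HS L KL.
- exact: rvmeas_attack.
- exact: attack_mean0 HS L KL.
Qed.

(** The part of y_i free of attack is independent of w_L. In the term lam_i w_i only whiteness
    relates w_i to w_L, so lam_i is averaged out first. *)
Lemma cross_attack_obs L i : K L -> K i -> i <> L ->
  cross P (attack S L) (obs S i) = 0.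
Proof.
move=> KL Ki iL'; have bl := lam_bernoulli HS Ki; have w2 := attack_L2 HS.
have z2 := zlin_L2 Ki; have sz2 := second_order_scalef bl z2.
have sw2 := second_order_scalef bl (w2 _ Ki).
have mz : rvmeas (rest iW) (zlin S i).
  apply: rvmeas_zlin.
  - by apply: rvmeas_Fam (rvmeas_signal Ki).
  - by apply: gmeas_Fam (gmeas_gam Ki).
  - by apply: rvmeas_Fam (rvmeas_noise Ki).
rewrite obsE crossDr//; [|exact: second_orderB|exact: w2].
rewrite cross_attack//; [|exact: second_orderB|]; last first.
  apply: rvmeasD => //; apply: rvmeasN; apply: rvmeas_scalef => //.
  by apply: gmeas_Fam (gmeas_lam Ki).
rewrite add0r -cross_tr cross_lam//; try exact: w2.
- rewrite -Covmx_cross; try exact: attack_mean0 HS _ _.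
  by rewrite (attack_white HS Ki KL iL') scaler0 trmx0.
- by apply: restL_vec (rvmeas_attack Ki).
- by apply: restL_vec (rvmeas_attack KL).
Qed.

(** * Orthogonality of the residual y_L - m_L *)

Lemma cross_obs_const1 L : K L -> cross P (obs S L - obs_mean L) const1 = 0.
Proof.
move=> KL; have o2 := second_order_const1 P.
apply: cross_obs => //; [exact: rvmeas_const1..|].
by apply: cross_attack => //; exact: rvmeas_const1.
Qed.

Lemma cross_obs_signal L k : K L -> K k ->
  cross P (obs S L - obs_mean L) (signal S k) = 0.
Proof.
move=> KL Kk; have x2 := signal_L2 HS Kk; have mx := rvmeas_signal Kk.
apply: cross_obs => //; [exact: restL_vec mx|exact: restG_vec mx|].
by apply: cross_attack => //; exact: rvmeas_Fam mx.
Qed.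

Lemma cross_obs_noise L k : K L -> K k ->
  cross P (obs S L - obs_mean L) (noise S k) = 0.
Proof.
move=> KL Kk; have v2 := noise_L2 k; have mx := rvmeas_noise Kk.
apply: cross_obs => //; [exact: restL_vec mx|exact: restG_vec mx|].
by apply: cross_attack => //; exact: rvmeas_Fam mx.
Qed.

Lemma cross_obs_obs L i : K L -> K i -> i <> L ->
  cross P (obs S L - obs_mean L) (obs S i) = 0.
Proof.
move=> KL Ki iL'; apply: cross_obs => //.
- exact: restL_obs.
- exact: restG_obs.
- exact: obs_L2.
- exact: cross_attack_obs.
Qed.

End SystemFacts.

(** * Innovations and smoothing *)

Section Recursion.
Context d (T : measurableType d) (R : realType) (P : probability T R).
Context (nx nz p : nat) (S : system R T nx nz p) (HS : assumptions P S).
Context (yhat : nat -> T -> 'cV[R]_nz).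
Context (Hyhat : forall j : nat, (1 <= j)%N ->
  LS_estimator P (obs S) j.-1 (obs S j) (yhat j)).
Context (Heta : forall j : nat, (1 <= j)%N -> Sigma_eta P S yhat j \in unitmx).

Local Notation dimk := (@Defs.dim nz p).
Local Notation eta := (eta S yhat).
Local Notation Se := (Sigma_eta P S yhat).
Local Notation Ps := (Psi P S yhat).
Local Notation ev := (evec P S yhat).
Local Notation Tm := (Tmx P S yhat).

Let o2 := second_order_const1 P.

Let y2 L : forall j, (1 <= j <= L)%N -> second_order P (obs S j).
Proof. by move=> j /andP[j1 _]; exact: obs_L2 HS j j1. Qed.

Lemma trmxB m n (A B : 'M[R]_(m, n)) : (A - B)^T = A^T - B^T.
Proof. exact: linearB. Qed.

Lemma etaE j : eta j = obs S j - yhat j.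
Proof. by apply/funext. Qed.

Lemma yhatP j : (1 <= j)%N -> [/\ second_order P (yhat j),
  inspan P (obs S) j.-1 (yhat j) & orth_span P (obs S) j.-1 (eta j)].
Proof.
by move=> j1; rewrite etaE; apply: LS_estimatorP;
  [exact: y2|exact: obs_L2 HS j j1|exact: Hyhat].
Qed.

Lemma eta_L2 j : (1 <= j)%N -> second_order P (eta j).
Proof.
move=> j1; have [yh2 _ _] := yhatP j1.
by rewrite etaE; apply: second_orderB => //; exact: obs_L2 HS j j1.
Qed.

Lemma eta_span j : (1 <= j)%N -> inspan P (obs S) j (eta j).
Proof.
move=> j1; have [_ sy _] := yhatP j1; rewrite etaE; apply: inspanB.
  by apply: inspan_obs; rewrite j1 leqnn.
exact: inspanS (leq_pred j) sy.
Qed.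

Lemma eta_orth j n (Z : T -> 'cV[R]_n) : (1 <= j)%N -> second_order P Z ->
  inspan P (obs S) j.-1 Z -> cross P (eta j) Z = 0.
Proof.
move=> j1 Z2 sZ; have [_ _ oe] := yhatP j1.
exact: orth_spanP (@y2 _) (eta_L2 j1) Z2 oe sZ.
Qed.

Lemma eta_const1 j : (1 <= j)%N -> cross P (eta j) const1 = 0.
Proof. by move=> j1; apply: eta_orth => //; exact: inspan_const1. Qed.

Lemma eta_eta i j : (1 <= i)%N -> (1 <= j)%N -> i <> j ->
  cross P (eta i) (eta j) = 0.
Proof.
have lt k l : (1 <= k)%N -> (k < l)%N -> cross P (eta l) (eta k) = 0.
  move=> k1 kl; have l1 : (1 <= l)%N by exact: leq_ltn_trans kl.
  apply: eta_orth => //; first exact: eta_L2.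
  by apply: inspanS (eta_span k1); rewrite -ltnS (ltn_predK kl).
move=> i1 j1 /eqP; rewrite neq_ltn => /orP[ij|ij]; last exact: lt.
by rewrite -cross_tr lt// trmx0.
Qed.

Lemma Se_tr j : (Se j)^T = Se j.
Proof. exact: cross_tr. Qed.

(** * The vectors e^a and the matrices T^{ab} *)

Lemma evecS a k : ev a k.+1 =
  ev a k + mxapp (Ps a k.+1 *m invmx (Se k.+1)) (eta k.+1).
Proof. by apply/funext. Qed.

Lemma TmxS k a b : Tm k.+1 a b =
  Tm k a b + Ps a k.+1 *m invmx (Se k.+1) *m (Ps b k.+1)^T.
Proof. by []. Qed.

Lemma Tmx_tr k a b : (Tm k a b)^T = Tm k b a.
Proof.
elim: k => [|k IHk]; first by rewrite /= trmx0.
rewrite !TmxS linearD /= IHk !trmx_mul trmxK mulmxA.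
by rewrite trmx_inv Se_tr.
Qed.

Lemma evec_L2 a k : second_order P (ev a k).
Proof.
elim: k => [|k IHk]; first exact: second_order0.
rewrite evecS; apply: second_orderD => //; apply: second_order_mxapp.
exact: eta_L2.
Qed.

Lemma evec_span a k : inspan P (obs S) k (ev a k).
Proof.
elim: k => [|k IHk]; first exact: inspan0.
rewrite evecS; apply: inspanD; first exact: inspanS IHk.
by apply: inspan_mxapp; exact: eta_span.
Qed.

Lemma evec_const1 a k : cross P (ev a k) const1 = 0.
Proof.
elim: k => [|k IHk]; first exact: cross0l.
have e2 := @evec_L2 a k; have h2 := eta_L2 (ltn0Sn k).
rewrite evecS crossDl//; last exact: second_order_mxapp.
by rewrite cross_mull// eta_const1// IHk mulmx0 addr0.
Qed.

(** e^a_L is a combination of mutually orthogonal innovations: only the j-th term survives, and the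
    inverse of Sigma^eta_j cancels E[eta_j eta_j^T]. *)
Lemma evec_eta a L j : (1 <= j)%N ->
  cross P (ev a L) (eta j) = if (j <= L)%N then Ps a j else 0.
Proof.
move=> j1; have hj := eta_L2 j1; elim: L => [|L IHL].
  by rewrite leqNgt j1 /=; exact: cross0l.
have e2 := @evec_L2 a L; have h2 := eta_L2 (ltn0Sn L).
rewrite evecS crossDl//; last exact: second_order_mxapp.
rewrite cross_mull// IHL; case: (eqVneq j L.+1) => [->|jL].
  by rewrite ltnn leqnn add0r -mulmxA mulVmx ?mulmx1//; exact: Heta.
rewrite eta_eta//; last by move=> jL'; rewrite jL' eqxx in jL.
by rewrite mulmx0 addr0 [in RHS]leq_eqVlt (negPf jL) ltnS.
Qed.

(** Testing against innovations suffices: y_j = eta_j + yhat_j with yhat_j in the span of 1 and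
    earlier observations, which strong induction has already covered. *)
Lemma orth_eta L n (U : T -> 'cV[R]_n) :
  second_order P U -> cross P U const1 = 0 ->
  (forall j, (1 <= j <= L)%N -> cross P U (eta j) = 0) ->
  orth_span P (obs S) L U.
Proof.
move=> U2 U1 Ueta; split=> //; elim/ltn_ind => j IHj /andP[j1 jL].
have [yh2 sy _] := yhatP j1.
have yE : obs S j = eta j + yhat j by rewrite etaE subrK.
rewrite yE crossDr//; last exact: eta_L2.
rewrite Ueta ?j1// add0r; apply: orth_spanP (@y2 _) U2 yh2 _ sy.
split=> // i /andP[i1 ij]; apply: IHj.
  by rewrite -(prednK j1) ltnS.
by rewrite i1 (leq_trans ij)// (leq_trans (leq_pred j)).
Qed.

(** The common left factor [F] comes out of the sum that defines T^{ba}. With Z = e^b_L and F = 1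
    this reads T^{ba}_L = E[e^b_L (e^a_L)^T]. *)
Lemma cross_evec n (Z : T -> 'cV[R]_n) b (F : 'M[R]_(n, dimk b)) a L :
  second_order P Z ->
  (forall j, (1 <= j <= L)%N -> cross P Z (eta j) = F *m Ps b j) ->
  cross P Z (ev a L) = F *m Tm L b a.
Proof.
move=> Z2; elim: L => [|L IHL] h; first by rewrite /= mulmx0; exact: cross0r.
have e2 := @evec_L2 a L; have h2 := eta_L2 (ltn0Sn L).
rewrite evecS TmxS crossDr//; last exact: second_order_mxapp.
rewrite cross_mulr// h ?leqnn//.
rewrite IHL => [|j /andP[j1 jL]]; last by apply: h; rewrite j1 ltnW.
by rewrite mulmxDr trmx_mul trmx_inv Se_tr !mulmxA.
Qed.

(* The predictor of y_L is obtained by replacing x_L and v_L in obs_mean by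
   their predictors A_L e^x_{L-1} and E_L e^v_{L-1}. *)
Definition ypred L : T -> 'cV[R]_nz :=
  mxapp ((1 - lambar P S L)%:M)
    (mxapp (gambar P S L *: Cvec S L) const1
     + mxapp (Del P S kx L) (ev kx L.-1) + mxapp (Del P S kv L) (ev kv L.-1)).

Lemma ypred_L2 L : second_order P (ypred L).
Proof.
apply: second_order_mxapp; apply: second_orderD; first apply: second_orderD;
  apply: second_order_mxapp => //; exact: evec_L2.
Qed.

Lemma ypred_span L : inspan P (obs S) L.-1 (ypred L).
Proof.
apply: inspan_mxapp; apply: inspanD; first apply: inspanD;
  apply: inspan_mxapp; [exact: inspan_const1|exact: evec_span|exact: evec_span].
Qed.

Lemma cross_ypred L n (Z : T -> 'cV[R]_n) : second_order P Z ->
  cross P (ypred L) Z = (1 - lambar P S L) *: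
    ((gambar P S L *: Cvec S L) *m cross P const1 Z
     + Del P S kx L *m cross P (ev kx L.-1) Z
     + Del P S kv L *m cross P (ev kv L.-1) Z).
Proof.
move=> Z2; have ex := @evec_L2 kx L.-1; have ew := @evec_L2 kv L.-1.
have c2 := second_order_mxapp (gambar P S L *: Cvec S L) o2.
have x2 := second_order_mxapp (Del P S kx L) ex.
have v2 := second_order_mxapp (Del P S kv L) ew.
rewrite cross_mull//; last by do 2?apply: second_orderD.
rewrite mul_scalar_mx crossDl//; last exact: second_orderD.
by rewrite crossDl// !cross_mull.
Qed.

(** The induction statement. All times k >= j are quantified inside because the predictor of y_L
    uses it at time L, for x and v together, with j < L. *)
Definition state_eta j : Prop := forall k, (j <= k)%N ->
  cross P (signal S k) (eta j) = facA S k *m Ps kx j /\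
  cross P (noise S k) (eta j) = Emat S k *m Ps kv j.

Lemma cross_obsP L n (Z : T -> 'cV[R]_n) : (1 <= L)%N -> second_order P Z ->
  cross P (obs S L - obs_mean P S L) Z = 0 ->
  cross P (obs S L) Z = cross P (obs_mean P S L) Z.
Proof.
move=> L1 Z2; rewrite crossBl//; [|exact: obs_L2 HS L L1|exact: obs_mean_L2 HS L L1].
by move/eqP; rewrite subr_eq0 => /eqP.
Qed.

Lemma obs_resid_span L n (Z : T -> 'cV[R]_n) : (1 <= L)%N ->
  second_order P Z -> inspan P (obs S) L.-1 Z ->
  cross P (obs S L) Z = cross P (obs_mean P S L) Z.
Proof.
move=> L1 Z2 sZ; apply: cross_obsP => //.
have r2 : second_order P (obs S L - obs_mean P S L).
  by apply: second_orderB; [exact: obs_L2 HS L L1|exact: obs_mean_L2 HS L L1].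
apply: orth_spanP (@y2 _) r2 Z2 _ sZ; split; first exact: cross_obs_const1 HS L L1.
move=> j /andP[j1 jL]; apply: (cross_obs_obs HS) => // jL'.
by move: jL; rewrite jL' -ltnS (prednK L1) ltnn.
Qed.

(** By uniqueness of the projection it suffices that y_L - [ypred L] is orthogonal to 1 and to the
    earlier innovations. *)
Lemma yhat_ypred L : (1 <= L)%N -> (forall j, (1 <= j < L)%N -> state_eta j) ->
  aeeq P (yhat L) (ypred L).
Proof.
move=> L1 h; have [yh2 sy oy] := yhatP L1.
have ob2 := obs_L2 HS L1; have yp2 := ypred_L2 L.
rewrite etaE in oy.
apply: (projection_unique (@y2 L.-1) ob2 yh2 yp2 sy (ypred_span L) oy).
apply: orth_eta; first exact: second_orderB.
  rewrite crossBl// (obs_resid_span L1 o2 (inspan_const1 _ _ _)).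
  rewrite (cross_obs_mean HS)// cross_ypred// !evec_const1 !mulmx0 !addr0.
  rewrite (cross_signal_const1 HS)// (cross_noise_const1 HS) mulmx0 add0r addr0.
  by rewrite scalemxAl subrr.
move=> j /andP[j1 jL]; have hj := eta_L2 j1.
have jL' : (j < L)%N by rewrite -(prednK L1) ltnS.
have sj := inspanS jL (eta_span j1).
rewrite crossBl// (obs_resid_span L1 hj sj).
rewrite (cross_obs_mean HS)// cross_ypred// !evec_eta// jL.
(* At time L the hypothesis gives A_L Psi^x_j and E_L Psi^v_j, matching the contributions of e^x and
   e^v to [ypred]. *)
have [|-> ->] := h j _ L (ltnW jL'); first by rewrite j1.
rewrite -(cross_tr P (eta j) const1) eta_const1// trmx0 !mulmx0 addr0 add0r.
by rewrite /= mulmxA scalemxAl subrr.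
Qed.

(** No order between L and the time of [Z] is imposed, so this serves both the induction, with k >=
    L, and smoothing, with k < L. *)
Lemma cross_eta n (Z : T -> 'cV[R]_n) L : (1 <= L)%N -> second_order P Z ->
  cross P (obs S L - obs_mean P S L) Z = 0 -> cross P Z const1 = 0 ->
  aeeq P (yhat L) (ypred L) ->
  cross P Z (eta L) = (1 - lambar P S L) *:
    (gambar P S L *: (cross P Z (signal S L) *m (Hmx S L)^T)
     + cross P Z (noise S L)
     - cross P Z (ev kx L.-1) *m (Del P S kx L)^T
     - cross P Z (ev kv L.-1) *m (Del P S kv L)^T).
Proof.
move=> L1 Z2 rZ Z1 yy; have [yh2 _ _] := yhatP L1.
have ob2 := obs_L2 HS L1; have yp2 := ypred_L2 L.
have Z1' : cross P const1 Z = 0 by rewrite -cross_tr Z1 trmx0.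
apply: trmx_inj; rewrite cross_tr etaE crossBl// (cross_ael yh2 yp2 Z2 yy).
rewrite (cross_obsP L1 Z2 rZ) (cross_obs_mean HS)// cross_ypred// Z1'.
rewrite mulmx0 mulmx0 addr0 add0r -scalerBr.
rewrite -(cross_tr P (signal S L)) -(cross_tr P (noise S L)).
rewrite -(cross_tr P (ev kx L.-1)) -(cross_tr P (ev kv L.-1)).
move: (Hmx S L) (Del P S kx L) (Del P S kv L) (cross P _ _) (cross P _ _)
  (cross P _ _) (cross P _ _) => H Dx Dv cx cv ex ew.
rewrite -!trmx_mul [RHS]linearZ /=; congr (_ *: _).
by rewrite !trmxB [in RHS]linearD /= linearZ /= !trmxK opprD addrA.
Qed.

(** Treats signal (F = A_k) and noise (F = E_k) alike: when the covariance of [Z] with the data at L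
    factors through Gamma^b_L, and earlier innovations factor through [F], the bracket left over is
    Psi^b_L. *)
Lemma cross_eta_factor n (Z : T -> 'cV[R]_n) b (F : 'M[R]_(n, dimk b)) L :
  (1 <= L)%N -> second_order P Z ->
  cross P (obs S L - obs_mean P S L) Z = 0 -> cross P Z const1 = 0 ->
  aeeq P (yhat L) (ypred L) ->
  (forall j, (1 <= j < L)%N -> cross P Z (eta j) = F *m Ps b j) ->
  gambar P S L *: (cross P Z (signal S L) *m (Hmx S L)^T)
    + cross P Z (noise S L) = F *m (Gam P S b L)^T ->
  cross P Z (eta L) = F *m Ps b L.
Proof.
move=> L1 Z2 rZ Z1 yy h hG; rewrite cross_eta// hG.
have h' j : (1 <= j <= L.-1)%N -> cross P Z (eta j) = F *m Ps b j.
  by move=> /andP[j1 jL]; apply: h; rewrite j1 -(prednK L1) ltnS.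
rewrite !(cross_evec _ Z2 h') /Psi /Psi_of.
(* The inner products produce T^{bx} and T^{bv}, whereas [Psi_of] contains T^{xb} and T^{vb}. *)
rewrite -(Tmx_tr L.-1 b kx) -(Tmx_tr L.-1 b kv) -scalemxAr.
move: (Gam P S b L) (Del P S kx L) (Del P S kv L) (Tm _ _ _) (Tm _ _ _).
move=> G Dx Dv Tx Tv; congr (_ *: _).
by rewrite !trmxB !trmx_mul !trmxK !mulmxBr !mulmxA.
Qed.

Lemma all_state_eta L : (1 <= L)%N -> state_eta L.
Proof.
elim/ltn_ind: L => L IHL L1 k Lk.
have k1 : (1 <= k)%N := leq_trans L1 Lk.
have IH j : (1 <= j < L)%N -> state_eta j by move=> /andP[j1 jL]; exact: IHL.
(* Times below L already fix the predictor of y_L, before anything is known about eta_L. *)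
have yy := yhat_ypred L1 IH.
have jk j : (1 <= j < L)%N -> (j <= k)%N.
  by move=> /andP[_ jL]; exact: leq_trans (ltnW jL) Lk.
split; [apply: (@cross_eta_factor _ _ kx)|apply: (@cross_eta_factor _ _ kv)] => //.
- exact: signal_L2 HS k k1.
- exact: cross_obs_signal HS L k L1 k1.
- exact: cross_signal_const1 HS k k1.
- by move=> j hj; have [] := IH j hj k (jk j hj).
(* L <= k enters here: E[x_k x_L^T] = A_k B_L^T, and the rest assembles into the transpose of
   Gamma^x_L. *)
- rewrite (cross_signal_noise HS)// addr0 (cross_signal HS)//.
  by rewrite /= linearZ /= trmx_mul -scalemxAr mulmxA.
- exact: noise_L2 HS k.
- exact: cross_obs_noise HS L k L1 k1.
- exact: cross_noise_const1 HS k.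
- by move=> j hj; have [] := IH j hj k (jk j hj).
- rewrite -(cross_tr P (signal S L)) (cross_signal_noise HS)// trmx0 mul0mx.
  by rewrite scaler0 add0r (cross_noise HS).
Qed.

Lemma yhatE L : (1 <= L)%N -> aeeq P (yhat L) (ypred L).
Proof. by move=> L1; apply: yhat_ypred => // j /andP[j1 _]; exact: all_state_eta. Qed.

(** * Fixed-point smoothing *)

Section Smoother.
Context (k : nat) (k1 : (1 <= k)%N) (xhat : nat -> T -> 'cV[R]_nx).
Context (Hxhat : forall L : nat, (k <= L)%N ->
  LS_estimator P (obs S) L (signal S k) (xhat L)).

Let x2 : second_order P (signal S k). Proof. exact: signal_L2 HS k k1. Qed.

(** Now k < L, so the covariance is read in the other order, E[x_k x_L^T] = (A_L B_k^T)^T = B_k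
    A_L^T, which turns the data term into B_k (Delta^x_L)^T. *)
Lemma SmxE L : (k < L)%N -> Smx P S yhat k L = (1 - lambar P S L) *:
   ((facB S k - Mmx P S yhat kx k L.-1) *m (Del P S kx L)^T
    - Mmx P S yhat kv k L.-1 *m (Del P S kv L)^T).
Proof.
move=> kL; have L1 : (1 <= L)%N := leq_ltn_trans (leq0n k) kL.
have -> : Smx P S yhat k L = cross P (signal S k) (eta L) by [].
rewrite cross_eta//; first last.
- exact: yhatE.
- exact: cross_signal_const1 HS k k1.
- exact: cross_obs_signal HS L k L1 k1.
rewrite (cross_signal_noise HS)// addr0 mulmxBl.
rewrite -(cross_tr P (signal S L)) (cross_signal HS k1 (ltnW kL)) trmx_mul trmxK.
have -> : facB S k *m (Del P S kx L)^T =
    gambar P S L *: (facB S k *m (facA S L)^T *m (Hmx S L)^T).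
  by rewrite /= linearZ /= trmx_mul -scalemxAr mulmxA.
by [].
Qed.

Lemma MmxS a L : (k < L)%N -> Mmx P S yhat a k L =
  Mmx P S yhat a k L.-1
  + Smx P S yhat k L *m invmx (Se L) *m (Ps a L)^T.
Proof.
case: L => // L kL; have e2 := @evec_L2 a L; have h2 := eta_L2 (ltn0Sn L).
have -> : Mmx P S yhat a k L.+1 = cross P (signal S k) (ev a L.+1) by [].
rewrite evecS crossDr//; last exact: second_order_mxapp.
by rewrite cross_mulr// trmx_mul trmx_inv Se_tr mulmxA.
Qed.

(** Only innovations of index at most k occur in e^a_k, so the left factor A_k is still
    available. *)
Lemma Mmx_diag a : Mmx P S yhat a k k = facA S k *m Tm k kx a.
Proof.
apply: (@cross_evec _ _ kx) => // j /andP[j1 jk].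
by have [] := all_state_eta j1 jk.
Qed.

(** The right-hand side lies in the span of the first L observations; its error is tested against 1
    and the innovations, and uniqueness of projections concludes. *)
Lemma xhat_rec L : (k < L)%N -> {ae P, forall w, xhat L w =
  xhat L.-1 w + Smx P S yhat k L *m invmx (Se L) *m eta L w}.
Proof.
move=> kL; have L1 : (1 <= L)%N := leq_ltn_trans (leq0n k) kL.
have kL' : (k <= L.-1)%N by rewrite -ltnS (prednK L1).
have [h2 hs ho] := LS_estimatorP (@y2 L) x2 (Hxhat (ltnW kL)).
have [g2 gs go] := LS_estimatorP (@y2 L.-1) x2 (Hxhat kL').
have e2 := eta_L2 L1.
pose C := Smx P S yhat k L *m invmx (Se L).
have C2 := second_order_mxapp C e2.
have r2 := second_orderB x2 g2.
apply: (projection_unique (@y2 L) x2 h2 (Z' := xhat L.-1 + mxapp C (eta L)) _ hs _ ho).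
- exact: second_orderD.
- apply: inspanD; first exact: inspanS (leq_pred L) gs.
  by apply: inspan_mxapp; exact: eta_span.
rewrite opprD addrA; apply: orth_eta; first exact: second_orderB.
  rewrite crossBl// cross_mull// eta_const1// mulmx0 subr0.
  by case: go.
move=> j /andP[j1 jL]; have ej2 := eta_L2 j1.
rewrite crossBl// cross_mull//; case: (eqVneq j L) => [->|jL'].
  (* For j = L the gain times Sigma^eta_L is [Smx], which is E[x_k eta_L^T], while xhat_{L-1} is
     orthogonal to eta_L. *)
  rewrite -mulmxA mulVmx ?mulmx1; last exact: Heta.
  rewrite crossBl// -(cross_tr P (eta L) (xhat L.-1)) eta_orth// trmx0 subr0.
  exact: subrr.
rewrite eta_eta//; last by move=> Lj; rewrite Lj eqxx in jL'.
(* For j < L the innovation lies in the span up to L - 1, to which the previous error is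
   orthogonal. *)
rewrite mulmx0 subr0; apply: orth_spanP (@y2 _) r2 ej2 go _.
by apply: inspanS (eta_span j1); rewrite -ltnS (prednK L1) ltn_neqAle jL' jL.
Qed.

End Smoother.
End Recursion.

Theorem theorem3p2 (d : measure_display) (T : measurableType d) (R : realType)
    (P : probability T R) (nx nz p : nat) (S : system R T nx nz p)
    (HS : assumptions P S)
    (yhat : nat -> T -> 'cV[R]_nz)
    (Hyhat : forall j : nat, (1 <= j)%N ->
       LS_estimator P (obs S) j.-1 (obs S j) (yhat j))
    (Heta : forall j : nat, (1 <= j)%N -> Sigma_eta P S yhat j \in unitmx)
    (k : nat) (hk : (1 <= k)%N)
    (xhat : nat -> T -> 'cV[R]_nx)
    (Hxhat : forall L : nat, (k <= L)%N ->
       LS_estimator P (obs S) L (signal S k) (xhat L)) :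
  (forall L : nat, (k < L)%N ->
     [/\ {ae P, forall w, xhat L w =
            xhat L.-1 w + Smx P S yhat k L *m invmx (Sigma_eta P S yhat L)
                            *m eta S yhat L w},
         Smx P S yhat k L = (1 - lambar P S L) *:
           ((facB S k - Mmx P S yhat kx k L.-1) *m (Del P S kx L)^T
            - Mmx P S yhat kv k L.-1 *m (Del P S kv L)^T)
       & forall a : kind, Mmx P S yhat a k L =
           Mmx P S yhat a k L.-1
           + Smx P S yhat k L *m invmx (Sigma_eta P S yhat L)
               *m (Psi P S yhat a L)^T]) /\
  (forall a : kind, Mmx P S yhat a k k = facA S k *m Tmx P S yhat k kx a).
Proof.
split=> [L kL|a]; last exact: Mmx_diag.
split=> [||a]; [exact: xhat_rec|exact: SmxE|exact: MmxS].
Qed.
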